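(* Let $m>0$ and $\rho_L,\rho_R>0$, and set $\alpha=\rho_L\frac m2$, $\gamma=(\rho_L+1)\frac m2$, $\sigma=\rho_R\frac m2$, $\beta=(\rho_R+1)\frac m2$. For each integer $N\ge1$ let $\nu^N_{\rho_L,\rho_R}$ be the unique stationary distribution of the boundary driven symmetric inclusion process on $\{0,1,2,\dots\}^{\{1,\dots,N\}}$ with parameters $\alpha,\gamma,\sigma,\beta$. Then the sequence $(\nu^N_{\rho_L,\rho_R})_{N}$ satisfies the local equilibrium property with the linear profile $\rho(x)=\rho_L+(\rho_R-\rho_L)x$, $x\in[0,1]$; that is, for all $n\ge1$ and all $x_1,\dots,x_n\in[0,1]$, $$ \lim_{N\to\infty}\int\mathcal{D}^{SIP}\Big(\sum_{i=1}^n\delta_{\lfloor x_iN\rfloor},\eta\Big)\,\nu^N_{\rho_L,\rho_R}(d\eta)=\prod_{i=1}^n\big(\rho_L+(\rho_R-\rho_L)x_i\big). $$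
   Context: The boundary driven symmetric inclusion process on $N$ sites with positive parameters $\alpha,\beta,\gamma,\sigma$ ($\gamma>\alpha$, $\beta>\sigma$) is the Markov process on $\{0,1,2,\dots\}^{\{1,\dots,N\}}$ with generator $$ \begin{aligned} \mathcal{L}f(\eta)={}&\alpha\Big(\frac m2+\eta_1\Big)\big(f(\eta+\delta_1)-f(\eta)\big)+\gamma\eta_1\big(f(\eta-\delta_1)-f(\eta)\big)\\ &+\sum_{i=1}^{N-1}\Big[\eta_i\Big(\frac m2+\eta_{i+1}\Big)\big(f(\eta-\delta_i+\delta_{i+1})-f(\eta)\big)+\eta_{i+1}\Big(\frac m2+\eta_i\Big)\big(f(\eta-\delta_{i+1}+\delta_i)-f(\eta)\big)\Big]\\ &+\sigma\Big(\frac m2+\eta_N\Big)\big(f(\eta+\delta_N)-f(\eta)\big)+\beta\eta_N\big(f(\eta-\delta_N)-f(\eta)\big), \end{aligned} $$ where $\delta_x$ is the configuration with a single particle at $x$ and none elsewhere. With the stated parameters, $\rho_L=\frac{\alpha}{\gamma-\alpha}$ and $\rho_R=\frac{\sigma}{\beta-\sigma}$. For $\xi\in\{0,1,2,\dots\}^{\{0,1,\dots,N+1\}}$ and $\eta\in\{0,1,2,\dots\}^{\{1,\dots,N\}}$, $$ \mathcal{D}^{SIP}(\xi,\eta)=\rho_L^{\xi_0}\left(\prod_{i=1}^N\frac{\eta_i!}{(\eta_i-\xi_i)!}\,\frac{\Gamma(\frac m2)}{\Gamma(\frac m2+\xi_i)}\right)\rho_R^{\xi_{N+1}}, $$ with the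 convention that the $i$-th factor of the product is $0$ if $\xi_i>\eta_i$. *)

(* Defs.v *)
From HB Require Import structures.
From mathcomp Require Import all_boot all_order all_algebra.
From mathcomp Require Import all_classical all_reals all_analysis.

Set Implicit Arguments.
Unset Strict Implicit.
Unset Printing Implicit Defensive.

Import Order.TTheory GRing.Theory Num.Theory.
Import numFieldNormedType.Exports.

Local Open Scope classical_set_scope.
Local Open Scope ring_scope.

(* Euler's Gamma function, for z > 0. *)
Definition Gamma (R : realType) (z : R) : R :=
  \int[lebesgue_measure]_(t in `]0, +oo[) (t `^ (z - 1) * expR (- t)).

(* Particle configurations on K sites.  For the inclusion process on {1, .., N}
   we take K = N and the index i : 'I_N stands for the site i + 1; for the dual
   configurations on {0, .., N+1} we take K = N.+2 and j : 'I_N.+2 stands for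
   the site j itself. *)
Definition config (K : nat) : Type := {ffun 'I_K -> nat}.

HB.instance Definition _ (K : nat) := Choice.on (config K).
HB.instance Definition _ (K : nat) := Countable.on (config K).
HB.instance Definition _ (K : nat) := isPointed.Build (config K) [ffun=> 0%N].
HB.instance Definition _ (K : nat) :=
  @isMeasurable.Build default_measure_display (config K)
    (@discrete_measurable (config K)) (@discrete_measurable0 (config K))
    (@discrete_measurableC (config K)) (@discrete_measurableU (config K)).

Definition add_at (K : nat) (i : 'I_K) (eta : config K) : config K :=
  [ffun k => (eta k + (k == i))%N].

(* The subtraction is truncated, but in the generator below this only ever
   occurs in terms carrying the factor eta i = 0. *)
Definition remove_at (K : nat) (i : 'I_K) (eta : config K) : config K :=
  [ffun k => (eta k - (k == i))%N].

(* The first and last sums have exactly one term when N > 0 (sites 1 and N); the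
   double sum ranges over the N - 1 nearest-neighbour bonds. *)
Definition sip_generator (R : realType) (m alpha gamma sigma beta : R)
    (N : nat) (f : config N -> R) (eta : config N) : R :=
  \sum_(i < N | i.+1 == 1%N)
     (alpha * (m / 2 + (eta i)%:R) * (f (add_at i eta) - f eta)
      + gamma * (eta i)%:R * (f (remove_at i eta) - f eta))
  + \sum_(i < N) \sum_(j < N | j == i.+1 :> nat)
     ((eta i)%:R * (m / 2 + (eta j)%:R)
        * (f (add_at j (remove_at i eta)) - f eta)
      + (eta j)%:R * (m / 2 + (eta i)%:R)
        * (f (add_at i (remove_at j eta)) - f eta))
  + \sum_(i < N | i.+1 == N)
     (sigma * (m / 2 + (eta i)%:R) * (f (add_at i eta) - f eta)
      + beta * (eta i)%:R * (f (remove_at i eta) - f eta)).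

(* (P t), t >= 0, is a semigroup of Markov transition kernels; the values at
   t < 0 are irrelevant. *)
Definition markov_semigroup (R : realType) (d : measure_display)
    (T : measurableType d) (P : R -> R.-pker T ~> T) : Prop :=
  (forall x A, measurable A -> P 0 x A = \d_x A) /\
  (forall (s t : R) x A, 0 <= s -> 0 <= t -> measurable A ->
     P (s + t) x A = (\int[P s x]_y P t y A)%E).

(* L f is the pointwise derivative of P t f at t = 0+ for every bounded f.  For
   a jump process on a countable space with finitely many possible jumps from
   each state, this says that its jump rates are those appearing in L. *)
Definition has_generator (R : realType) (d : measure_display)
    (T : measurableType d) (P : R -> R.-pker T ~> T)
    (L : (T -> R) -> T -> R) : Prop :=
  forall f : T -> R, measurable_fun setT f ->
    (exists M : R, forall x, `|f x| <= M) ->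
    forall x, ((\int[P t x]_y f y) - f x) / t @[t --> 0^'+] --> L f x.

Definition stationary (R : realType) (d : measure_display)
    (T : measurableType d) (P : R -> R.-pker T ~> T)
    (nu : probability T R) : Prop :=
  forall (t : R) A, 0 <= t -> measurable A -> (\int[nu]_x P t x A)%E = nu A.

Definition sip_duality (R : realType) (m rhoL rhoR : R) (N : nat)
    (xi : config N.+2) (eta : config N) : R :=
  rhoL ^+ xi ord0
  * (\prod_(i < N)
      let k := xi (inord i.+1) in
      if (k <= eta i)%N
      then ((eta i)`!)%:R / ((eta i - k)`!)%:R
           * (Gamma (m / 2) / Gamma (m / 2 + k%:R))
      else 0)
  * rhoR ^+ xi ord_max.

(* The dual configuration sum_i delta_(floor (x_i N)); Num.truncn is the floor
   on nonnegative reals. *)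
Definition macro_config (R : realType) (n : nat) (x : 'I_n -> R) (N : nat) :
    config N.+2 :=
  [ffun j : 'I_N.+2 =>
     (\sum_(i < n) (Num.truncn (x i * N%:R) == j :> nat))%N].

(* Main.v *)
Require Import Defs.
From HB Require Import structures.
From mathcomp Require Import all_boot all_order all_algebra.
From mathcomp Require Import all_classical all_reals all_analysis.
From mathcomp Require Import measurable_realfun.
From mathcomp Require Import zify ring lra.

Set Implicit Arguments.
Unset Strict Implicit.
Unset Printing Implicit Defensive.
Import Order.TTheory GRing.Theory Num.Theory.
Import numFieldNormedType.Exports.

Local Open Scope classical_set_scope.
Local Open Scope ring_scope.

(** The proof is by duality. As a function of [eta], the function [D xi eta]
    measuring correlations is mapped by the generator of the process to what the
    generator of finitely many dual particles makes of it as a function of [xi]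
    (lemma [duality]). The dual particles perform symmetric walks on
    {0, .., N + 1}, are absorbed at 0 and N + 1, and each of them moreover jumps
    onto its interior neighbours at rate 1. Hence the stationary correlation
    [H y = \int D (occ y) d nu], as a function of the positions [y] of the dual
    particles, is harmonic for them (lemma [correlation_harmonic]), and once all
    are absorbed it is the product [G y] of the values of the linear profile.

    Without the attraction between neighbours [G] would be harmonic as well. The
    attraction changes [G] at a rate of the order of the squared slope of the
    profile, [N ^- 2], for each pair of neighbours (lemma
    [product_profile_drift]). The total separation of the particles is at most of
    order [N], and it decreases in mean at a rate proportional to the number of
    pairs of neighbours: it is a concave function of the distances, with its kink
    at distance 1, and it does not see the attraction because it is constant on
    distances 0 and 1 (lemma [total_separation_drift]). By the maximum principle
    [G <= H <= G + C * N ^- 1] (lemma [dual_harmonic_close]), and [G] converges to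
    the product of the profile at the macroscopic points.

    The harmonicity of [H] needs [\int L (D xi) d nu = 0] for the unbounded
    function [D xi], whereas the semigroup is related to the generator on bounded
    functions. Truncating at a high level shows that [L V <= c - g] with [V] proper
    and nonnegative implies [\int g d nu <= c] (lemma [Foster_Lyapunov]). Applied to
    [V = W * th ^+ k], where [k] is the number of particles and [W] the sum of
    [i * (N + 1 - i)] over their positions [i], this gives an exponential moment
    (lemmas [exists_Lyapunov] and [exists_exp_moment]). Applied to a small multiple
    of this [V] plus or minus a function growing more slowly than every
    exponential, such as [D xi], it gives the vanishing of the mean of the generator
    (lemma [stationary_generator0]). The quotients of Gamma functions in [D] become
    rising factorials by the functional equation (lemma [GammaS]). *)

(** * The Gamma function *)

Section Gamma_function.
Context {R : realType}.
Implicit Types z t : R.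
Local Notation mu := (@lebesgue_measure R).

Let kern z t : R := t `^ (z - 1) * expR (- t).
Let itv n : set R := `[n.+2%:R^-1, n.+2%:R].

Let pos : set R := `]0, +oo[.

Let itv_gt0 n t : itv n t -> 0 < t.
Proof. by rewrite /itv /= in_itv /= => /andP[/(lt_le_trans _)->]. Qed.

Let bigcup_itv : \bigcup_n itv n = pos.
Proof.
apply/seteqP; split => [t [n _ /itv_gt0 t0]|t]; rewrite /pos /= in_itv /= andbT //.
move=> t0; exists (Num.truncn t + Num.truncn t^-1)%N => //.
rewrite /itv /= in_itv /= -[X in _ <= X <= _]invrK lef_pV2 ?posrE ?invr_gt0 ?ltr0n //.
have h (x : R) : 0 <= x -> x <= (Num.truncn x).+1%:R.
  by move=> x0; apply/ltW/Num.Theory.truncnS_gt.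
apply/andP; split; rewrite ?invrK; (apply: (le_trans (h _ _)); [by rewrite ?invr_ge0 ltW|]);
  rewrite ler_nat !ltnS; [exact/leqW/leq_addl|exact/leqW/leq_addr].
Qed.

Let kern_ge0 z t : 0 <= kern z t.
Proof. by rewrite mulr_ge0 ?powR_ge0 ?expR_ge0. Qed.

Let measurable_kern z (D : set R) :
  measurable_fun D (fun t => (kern z t)%:E).
Proof.
apply/measurable_EFinP/measurable_funTS/measurable_funM.
  exact: measurable_powR.
by apply: measurableT_comp.
Qed.

Let cvg_kern z :
  (\int[mu]_(t in itv n) (kern z t)%:E)%E @[n --> \oo] -->
  (\int[mu]_(t in pos) (kern z t)%:E)%E.
Proof.
rewrite -bigcup_itv; apply: ge0_nondecreasing_set_cvg_integral.
- apply/nondecreasing_seqP => n; apply/subsetPset => t.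
  rewrite /itv /= !in_itv /= => /andP[h1 h2]; apply/andP; split.
    by apply: le_trans h1; rewrite lef_pV2 ?posrE ?ltr0n // ler_nat.
  by apply: le_trans h2 _; rewrite ler_nat.
- by move=> n; exact: measurable_itv.
- by move=> n; exact: measurable_kern.
- by move=> n t _; rewrite lee_fin.
Qed.

Let prim z t : R := t `^ z * expR (- t).

Let is_derive_prim z t : 0 < t ->
  is_derive t 1 (prim z) (z * kern z t - kern (z + 1) t).
Proof.
move=> t0; rewrite /prim.
have h1 := is_derive1_powR z t0.
have h2 : is_derive t 1 (fun x : R => expR (- x)) (- expR (- t)).
  by apply: is_derive_eq; rewrite /GRing.scale /= ?mulN1r ?mulrN1.
apply: (is_derive_eq (is_deriveM h1 h2)).
rewrite /kern /GRing.scale /= addrK; ring.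
Qed.

Let continuous_kern z t : 0 < t -> {for t, continuous (kern z)}.
Proof.
move=> t0; apply: continuousM.
  apply: differentiable_continuous; apply/derivable1_diffP.
  by case: (is_derive1_powR (z - 1) t0).
by apply: continuous_comp; [exact: opp_continuous|exact: continuous_expR].
Qed.

Let itv_FTC z n :
  (\int[mu]_(t in itv n) (z * kern z t - kern (z + 1) t)%:E =
   (prim z n.+2%:R)%:E - (prim z n.+2%:R^-1)%:E)%E.
Proof.
have ab : (n.+2%:R^-1 < n.+2%:R :> R).
  by apply: (@lt_trans _ _ 1); rewrite ?invf_lt1 ?ltr0n // ltr1n.
have a0 : (0 < n.+2%:R^-1 :> R) by rewrite invr_gt0 ltr0n.
have cprim t : 0 < t -> {for t, continuous (prim z)}.
  move=> t0; apply: differentiable_continuous; apply/derivable1_diffP.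
  by case: (is_derive_prim z t0).
apply: continuous_FTC2 => //.
- apply: continuous_in_subspaceT => t; rewrite inE => /itv_gt0 t0.
  apply: cvgB; last exact: continuous_kern.
  by apply: cvgM; [exact: cvg_cst|exact: continuous_kern].
- split.
  + move=> t; rewrite in_itv /= => /andP[/(lt_trans a0) t0 _].
    by case: (is_derive_prim z t0).
  + by apply: cvg_at_right_filter; apply: cprim.
  + by apply: cvg_at_left_filter; apply: cprim; exact: lt_trans ab.
- move=> t; rewrite in_itv /= => /andP[/(lt_trans a0) t0 _].
  by rewrite derive1E; case: (is_derive_prim z t0).
Qed.

Let integrable_kern z n : mu.-integrable (itv n) (EFin \o kern z).
Proof.
apply: continuous_compact_integrable; first exact: segment_compact.
apply: continuous_in_subspaceT => t; rewrite inE => /itv_gt0 h. exact: continuous_kern.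
Qed.

Let kern_itv_fin z n : (\int[mu]_(t in itv n) (kern z t)%:E)%E \is a fin_num.
Proof.
by apply: integrable_fin_num; [exact: measurable_itv|exact: integrable_kern].
Qed.

(** Integration by parts on a compact interval, written with both sides
    nonnegative so that it passes to the improper integrals by monotone
    convergence. *)
Let itv_parts z n : 0 < z ->
  (z%:E * \int[mu]_(t in itv n) (kern z t)%:E + (prim z n.+2%:R^-1)%:E =
   \int[mu]_(t in itv n) (kern (z + 1) t)%:E + (prim z n.+2%:R)%:E)%E.
Proof.
move=> z0.
have mi : measurable (itv n) by exact: measurable_itv.
have := itv_FTC z n.
under eq_integral do rewrite EFinB EFinM.
rewrite integralB //=; last 2 first.
  by apply: integrableZl => //; exact: integrable_kern.
  exact: integrable_kern.
rewrite integralZl //=; last exact: integrable_kern.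
rewrite -(fineK (kern_itv_fin z n)) -(fineK (kern_itv_fin (z + 1) n)).
rewrite -!EFinM -!EFinN -!EFinD => -[h]; congr EFin; lra.
Qed.

Let prim_ge0 z t : 0 <= prim z t.
Proof. by rewrite mulr_ge0 ?powR_ge0 ?expR_ge0. Qed.

Let cvg_inv_shift : (n.+2%:R^-1 : R) @[n --> \oo] --> 0.
Proof.
have := @cvg_harmonic R; rewrite -(cvg_shiftn 1).
by under eq_fun do rewrite /= addn1.
Qed.

Let prim_cvg0 z : 0 < z -> prim z n.+2%:R^-1 @[n --> \oo] --> 0.
Proof.
move=> z0.
have /cvg_at_rightP hp := powR_cvg0 z0.
apply: (@squeeze_cvgr _ _ _ _ (fun=> 0) (fun n => (n.+2%:R^-1 : R) `^ z)).
- apply: nearW => n; rewrite prim_ge0 /= /prim.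
  apply: ler_piMr; first exact: powR_ge0.
  by rewrite expR_le1 oppr_le0 invr_ge0.
- exact: cvg_cst.
- by apply: hp; split => // n; rewrite invr_gt0.
Qed.

(** Since [z < k], bounding the exponential below by the term of degree [k.+1] of
    its series leaves a constant multiple of [t^-1]. *)
Let prim_cvgy z : 0 < z -> prim z n.+2%:R @[n --> \oo] --> 0.
Proof.
move=> z0; pose k := (Num.truncn z).+1.
apply: (@squeeze_cvgr _ _ _ _ (fun=> 0) (fun n => k.+1`!%:R * n.+2%:R^-1)).
- apply: nearW => n; rewrite prim_ge0 /= /prim.
  have n1 : 1 <= n.+2%:R :> R by rewrite ler1n.
  have n0 : 0 < n.+2%:R :> R by rewrite ltr0n.
  have h1 : n.+2%:R `^ z <= n.+2%:R ^+ k :> R.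
    rewrite -powR_mulrn; last exact: ltW.
    by apply: ler_powR => //; apply/ltW/Num.Theory.truncnS_gt.
  have h2 : n.+2%:R ^+ k.+1 <= k.+1`!%:R * expR n.+2%:R :> R.
    rewrite mulrC -ler_pdivrMr ?ltr0n ?fact_gt0 //.
    by apply: le_trans (expR_ge1Dxn k (ltW n0)); rewrite lerDr.
  rewrite expRN ler_pdivrMr ?expR_gt0 // (le_trans h1) //.
  by rewrite mulrAC ler_pdivlMr // -exprSr.
- exact: cvg_cst.
- by rewrite -[0](mulr0 (k.+1`!%:R)); apply: cvgM; [exact: cvg_cst|exact: cvg_inv_shift].
Qed.

Let iGamma z := (\int[mu]_(t in pos) (kern z t)%:E)%E.

Let iGamma_rec z : 0 < z -> (z%:E * iGamma z = iGamma (z + 1))%E.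
Proof.
move=> z0.
have h1 : (z%:E * \int[mu]_(t in itv n) (kern z t)%:E +
      (prim z n.+2%:R^-1)%:E)%E @[n --> \oo] --> (z%:E * iGamma z + 0%:E)%E.
  apply: cvgeD => //; last by apply/fine_cvgP; split; [exact: nearW|exact: prim_cvg0].
    by apply: fin_num_adde_defl.
  by apply: cvgeZl => //; exact: cvg_kern.
have h2 : (\int[mu]_(t in itv n) (kern (z + 1) t)%:E +
      (prim z n.+2%:R)%:E)%E @[n --> \oo] --> (iGamma (z + 1) + 0%:E)%E.
  apply: cvgeD => //; last by apply/fine_cvgP; split; [exact: nearW|exact: prim_cvgy].
    by apply: fin_num_adde_defl.
move: h1; under eq_fun do rewrite itv_parts //.
move=> h1; have := cvg_unique (@ereal_hausdorff R) h1 h2.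
by rewrite !adde0; apply.
Qed.

Let mpos : measurable (pos : set (measurableTypeR R)).
Proof. exact: measurable_itv. Qed.

Let iGamma1 : iGamma 1 = 1%E.
Proof.
have ce (x : R) : {for x, continuous (fun x : R => expR (- x))}.
  apply: continuous_comp; first exact: opp_continuous.
  exact: continuous_expR.
have de (x : R) : is_derive x 1 (fun x : R => - expR (- x)) (expR (- x)).
  by apply: is_derive_eq; rewrite /GRing.scale /= mulrN1 opprK.
rewrite /iGamma /pos.
under eq_integral do rewrite /kern subrr powRr0 mul1r.
rewrite integral_itv_obnd_cbnd; last first.
  by apply/measurable_EFinP; apply: measurableT_comp => //; exact: measurable_funTS.
rewrite (@ge0_continuous_FTC2y _ _ (fun x => - expR (- x)) _ 0).
- by rewrite oppr0 expR0 EFinN oppeK add0e.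
- by move=> x _; exact: expR_ge0.
- by apply: continuous_subspaceT => x; exact: ce.
- by rewrite -[0]oppr0; apply: cvgN; exact: cvgr_expR.
- by move=> x _; case: (de x).
- by apply: cvgN; apply/cvg_at_right_filter; exact: ce.
- by move=> x _; rewrite derive1E; case: (de x).
Qed.

Let iGamma_ge0 z : (0 <= iGamma z)%E.
Proof. by apply: integral_ge0 => t _; rewrite lee_fin. Qed.

Let iGamma_nat n : iGamma n.+1%:R \is a fin_num.
Proof.
elim: n => [|n IH]; first by rewrite iGamma1.
by rewrite -[n.+2]addn1 natrD -iGamma_rec ?ltr0n // fin_numM.
Qed.

(** On the half-line [t ^ z <= 1 + t ^ k] as soon as [0 < z <= k], and at integers
    finiteness follows from the recursion. *)
Let iGamma_fin z : 0 < z -> iGamma z \is a fin_num.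
Proof.
move=> z0; pose k := (Num.truncn z).+1.
have le_kern t : pos t ->
    ((kern (z + 1) t)%:E <= (kern 1 t)%:E + (kern k.+1%:R t)%:E)%E.
  rewrite /pos /= in_itv /= andbT -EFinD lee_fin /kern => t0.
  rewrite addrK subrr powRr0 -mulrDl ler_pM2r ?expR_gt0 //.
  rewrite -[k.+1]addn1 natrD addrK.
  have [t1|/ltW t1] := leP 1 t.
    rewrite (le_trans (_ : _ <= t `^ k%:R)) ?lerDr //.
    by apply: ler_powR => //; apply/ltW/Num.Theory.truncnS_gt.
  rewrite (le_trans (_ : _ <= 1)) ?lerDl ?powR_ge0 //.
  rewrite -(powRr0 t); apply: ger_powR; last exact: ltW.
  by rewrite t0.
have : (iGamma (z + 1) < +oo)%E.
  apply: (@le_lt_trans _ _ (iGamma 1 + iGamma k.+1%:R)%E).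
    rewrite -ge0_integralD //.
    + apply: ge0_le_integral => //.
      * by move=> t _; rewrite lee_fin.
      * exact: measurable_kern.
      * by apply: emeasurable_funD => //; exact: measurable_kern.
    + by move=> t _; rewrite lee_fin.
    + exact: measurable_kern.
    + by move=> t _; rewrite lee_fin.
    + exact: measurable_kern.
  by rewrite iGamma1 lte_add_pinfty ?ltry // ltey_eq iGamma_nat.
rewrite -iGamma_rec // => h.
rewrite ge0_fin_numE //; move: h; rewrite !ltey; apply: contra => /eqP ->.
by rewrite gt0_muley ?lte_fin.
Qed.

(** The recursion moves the exponent to a positive one, for which the integrand
    is bounded below on [1, 2]. *)
Let iGamma_gt0 z : 0 < z -> (0 < iGamma z)%E.
Proof.
move=> z0; suff : (0 < iGamma (z + 1))%E.
  by rewrite -iGamma_rec // pmule_rgt0 ?lte_fin.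
have mI : measurable (`[1, 2] : set (measurableTypeR R)).
  exact: measurable_itv.
apply: (@lt_le_trans _ _ (\int[mu]_(t in `[1%R, 2%R]) (cst (expR (- 2))%:E t))%E).
  rewrite integral_cst //= lebesgue_measure_itv /= lte_fin ltr1n.
  rewrite -EFinB -EFinM lte_fin mulr_gt0 ?expR_gt0 //; lra.
apply: (@le_trans _ _ (\int[mu]_(t in `[1%R, 2%R]) (kern (z + 1) t)%:E)%E).
  apply: ge0_le_integral => //.
  - by move=> t _; rewrite lee_fin expR_ge0.
  - exact: measurable_kern.
  - move=> t; rewrite /= in_itv /= lee_fin => /andP[t1 t2].
    rewrite /kern addrK -[X in X <= _]mul1r ler_pM ?expR_ge0 //.
      by rewrite -(powRr0 t); apply: ler_powR => //; exact: ltW.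
    by rewrite ler_expR lerN2.
apply: ge0_subset_integral => //.
- exact: measurable_kern.
- by move=> t _; rewrite lee_fin.
- by move=> t; rewrite /pos /= !in_itv /= andbT => /andP[/(lt_le_trans _)->].
Qed.

Lemma Gamma_gt0 z : 0 < z -> 0 < Gamma z.
Proof. by move=> z0; apply: fine_gt0; rewrite iGamma_gt0 //= ltey_eq iGamma_fin. Qed.

Lemma GammaS z : 0 < z -> Gamma (z + 1) = z * Gamma z.
Proof.
move=> z0; rewrite /Gamma /Rintegral -[X in fine X]/(iGamma (z + 1)).
by rewrite -iGamma_rec // fineM ?iGamma_fin.
Qed.
End Gamma_function.

(** * Moment bounds for stationary measures *)

Section Foster_Lyapunov.
Context {R : realType} {d : measure_display} {T : measurableType d}.
Variables (P : R -> R.-pker T ~> T) (L : (T -> R) -> T -> R).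
Variable nu : probability T R.

Lemma stationary_integral (t : R) (f : T -> \bar R) :
  stationary P nu -> 0 <= t -> measurable_fun [set: T] f ->
  (forall x, (0 <= f x)%E) ->
  (\int[nu]_x (\int[P t x]_y f y) = \int[nu]_x f x)%E.
Proof.
move=> statP t0 mf f0.
(* The mixture of the kernels under [nu] is the composition of [P t] with the
   constant kernel [nu] on the one-point space. *)
pose l := kprobability (measurable_cst (nu : pprobability T R)
                        : measurable_fun [set: unit] _).
pose k : unit * T -> {measure set T -> \bar R} := kernel.kernel_snd (P t).
have := @integral_kcomp _ _ _ unit T T R l k tt f f0 mf.
rewrite /= => <-; apply: eq_measure_integral => A mA _.
exact: statP.
Qed.

(** Truncating [V] at a level [K] makes the generator applicable, and off the
    finite set where [V] is below [K] the truncation sits at its maximum and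
    cannot increase in mean; so one small time step serves all starting points,
    and stationarity makes the total increment vanish. *)
Lemma Foster_Lyapunov (V g : T -> R) (c : R) :
  has_generator P L -> stationary P nu ->
  (forall f h x, (forall y, f y <= h y) -> f x = h x -> L f x <= L h x) ->
  measurable_fun [set: T] V -> measurable_fun [set: T] g ->
  (forall x, 0 <= V x) -> (forall K, finite_set [set x | V x < K]) ->
  (forall x, 0 <= g x) -> 0 <= c -> (forall x, L V x <= c - g x) ->
  (\int[nu]_x (g x)%:E <= c%:E)%E.
Proof.
move=> genP statP L_le mV mg V0 finV g0 c0 LV.
pose F (n : nat) : set T := [set x | V x < n%:R].
have mF n : measurable (F n).
  rewrite /F -[X in measurable X]setTI.
  rewrite (_ : [set x | V x < n%:R] = V @^-1` `]-oo, n%:R[); last first.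
    by apply/seteqP; split => x /=; rewrite in_itv.
  by apply: mV.
have FT : \bigcup_n F n = setT.
  apply/seteqP; split => // x _; exists (Num.truncn (V x)).+1 => //.
  exact: Num.Theory.truncnS_gt.
have mgE (A : set T) : measurable_fun A (EFin \o g).
  by apply/measurable_EFinP; exact: measurable_funTS.
rewrite -FT.
have : (\int[nu]_(x in F n) (g x)%:E)%E @[n --> \oo] -->
    (\int[nu]_(x in \bigcup_n F n) (g x)%:E)%E.
  apply: ge0_nondecreasing_set_cvg_integral => //.
  - apply/nondecreasing_seqP => n; apply/subsetPset => x /=.
    by rewrite /F /= => /lt_le_trans; apply; rewrite ler_nat.
  - by move=> n x _; rewrite lee_fin.
move=> cvF; apply: (closed_cvg (fun x => (x <= c%:E)%E) _ _ _ cvF).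
  exact: closed_ereal_ge_ereal.
apply: nearW => n; apply/lee_addgt0Pr => e e0.
(* The bound is proved on the sublevel set [F n] up to an error [e]. *)
pose u x := Num.min (V x) n%:R.
have mu : measurable_fun [set: T] u by apply: measurable_minr => //.
have u0 x : 0 <= u x by rewrite /u le_min V0 ler0n.
have un x : u x <= n%:R by rewrite /u ge_min lexx orbT.
have muE (A : set T) : measurable_fun A (EFin \o u).
  by apply/measurable_EFinP; exact: measurable_funTS.
have Pu_le h x : (\int[P h x]_y (u y)%:E <= n%:R%:E)%E.
  apply: (@le_trans _ _ (\int[P h x]_y (n%:R%:E))%E).
    by apply: ge0_le_integral => //; move=> y _; rewrite lee_fin ?ler0n.
  by rewrite integral_cst //= prob_kernel mule1.
have Pu0 h x : (0 <= \int[P h x]_y (u y)%:E)%E.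
  by apply: integral_ge0 => y _; rewrite lee_fin.
have Pu_fin h x : (\int[P h x]_y (u y)%:E)%E \is a fin_num.
  by rewrite ge0_fin_numE // (le_lt_trans (Pu_le h x)) // ltry.
have [h [h0 Hh]] : exists h : R, 0 < h /\ forall x, F n x ->
    (\int[P h x]_y u y) <= u x + h * (c - g x + e).
  have [s Fs] := (finite_seqP (F n)).1 (finV n%:R).
  have : \forall h \near (0 : R)^'+, 0 < h /\ forall x, x \in s ->
      (\int[P h x]_y u y) <= u x + h * (c - g x + e).
    have : forall x, x \in s -> V x < n%:R.
      by move=> x xs; have : F n x by rewrite Fs.
    elim: s {Fs} => [|a s IH] Hs.
      by near=> h; split=> //.
    have Ha := genP u mu _ a.
    have {}Ha : (\int[P t a]_y u y - u a) / t @[t --> 0^'+] --> L u a.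
      by apply: Ha; exists n%:R => x; rewrite ger0_norm.
    have La : L u a < c - g a + e.
      apply: (@le_lt_trans _ _ (c - g a)); last by rewrite ltrDl.
      apply: le_trans (LV a); apply: L_le.
        by move=> y; rewrite /u ge_min lexx.
      by rewrite /u min_l // ltW // Hs // mem_head.
    have H1 := cvgr_lt _ Ha _ La.
    have {}IH := IH (fun x xs => Hs x (mem_behead (s := a :: s) xs)).
    near=> h.
    have [h0 h1] : 0 < h /\ forall x, x \in s ->
        (\int[P h x]_y u y) <= u x + h * (c - g x + e) by near: h.
    split => // x; rewrite in_cons => /orP[/eqP ->|]; last exact: h1.
    rewrite -lerBlDl mulrC -ler_pdivrMr //; apply: ltW; near: h; exact: H1.
  move=> /filter_ex[h [h0 Hh]]; exists h; split => // x; rewrite Fs /=; exact: Hh.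
have key x : (\int[P h x]_y (u y)%:E + h%:E * (g \_ (F n) x)%:E <=
             (u x)%:E + (h * (c + e))%:E)%E.
  have [xF|xF] := pselect (F n x).
    have := Hh x xF; rewrite /Rintegral patchE mem_set //.
    rewrite -(fineK (Pu_fin h x)) -EFinM -!EFinD lee_fin => H1.
    by move: H1; lra.
  rewrite patchE memNset // mule0 adde0.
  rewrite (_ : u x = n%:R); last first.
    by rewrite /u min_r // leNgt; apply/negP.
  apply: (le_trans (Pu_le h x)); rewrite -EFinD lee_fin lerDl.
  by rewrite mulr_ge0 // ?addr_ge0 // ltW.
have IuE := stationary_integral statP (ltW h0) (muE setT)
  (fun x => (_ : (0 <= (u x)%:E)%E)).
have {}IuE : (\int[nu]_x (\int[P h x]_y (u y)%:E) = \int[nu]_x (u x)%:E)%E.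
  by apply: IuE => x; rewrite lee_fin.
have Iu_fin : (\int[nu]_x (u x)%:E)%E \is a fin_num.
  rewrite ge0_fin_numE; last by apply: integral_ge0 => y _; rewrite lee_fin.
  apply: (@le_lt_trans _ _ (\int[nu]_y (n%:R%:E))%E); last first.
    by rewrite integral_cst //= probability_setT mule1 ltry.
  by apply: ge0_le_integral => //; move=> y _; rewrite lee_fin ?ler0n.
have mPu : measurable_fun [set: T] (fun x => \int[P h x]_y (u y)%:E)%E.
  apply: measurable_fun_integral_kernel => //.
  by move=> U mU; exact: measurable_kernel.
have gF0 x : 0 <= (g \_ (F n)) x by rewrite patchE; case: ifP.
have mgF : measurable_fun [set: T] (fun x => ((g \_ (F n)) x)%:E).
  apply/measurable_EFinP; apply/(measurable_restrictT _ (mF n)).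
  exact: measurable_funTS.
have ce0 : 0 <= c + e by rewrite addr_ge0 // ltW.
have : (\int[nu]_x (\int[P h x]_y (u y)%:E + h%:E * (g \_ (F n) x)%:E) <=
        \int[nu]_x ((u x)%:E + (h * (c + e))%:E))%E.
  apply: ge0_le_integral => //.
  - by move=> x _; rewrite adde_ge0 // mule_ge0 // lee_fin // ltW.
  - by apply: emeasurable_funD => //; apply: measurable_funeM.
  - by apply: emeasurable_funD => //; exact: muE.
rewrite ge0_integralD //; last 2 first.
- by move=> x _; rewrite mule_ge0 // lee_fin // ltW.
- exact: measurable_funeM.
rewrite [X in (_ <= X)%E]ge0_integralD //; last 2 first.
- by move=> x _; rewrite lee_fin.
- by move=> x _; rewrite lee_fin mulr_ge0 // ltW.
rewrite IuE leeD2lE // integral_cst //= probability_setT mule1.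
rewrite ge0_integralZl //; last 2 first.
- by move=> x _; rewrite lee_fin.
- by rewrite lee_fin ltW.
rewrite EFinM lee_pmul2l // ?lte_fin // -EFinD.
rewrite [X in _ -> (X <= _)%E]integral_mkcond restrict_EFin.
Unshelve. all: by end_near. Qed.

End Foster_Lyapunov.

(** * Duality *)

Section sites.
Context {R : realType}.
Context {N : nat}.

Definition site (i : 'I_N) : 'I_N.+2 := inord i.+1.

Lemma siteE (i : 'I_N) : site i = i.+1 :> nat.
Proof. by rewrite inordK // !ltnS ltnW. Qed.

Lemma site_inj : injective site.
Proof. by move=> i j /(congr1 val); rewrite /= !siteE => -[] /val_inj. Qed.

Definition interior (j : 'I_N.+2) := (0 < j < N.+1)%N.
Definition adjacent (i j : nat) := (j == i.+1) || (i == j.+1).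

Lemma interior_site i : interior (site i).
Proof. by rewrite /interior siteE /= ltnS. Qed.

(** The dual sites are the two reservoirs and the sites of the process. *)
Lemma sum_sites (A : pred 'I_N.+2) (h : 'I_N.+2 -> R) :
  \sum_(j | A j) h j = (if A ord0 then h ord0 else 0)
    + \sum_(i | A (site i)) h (site i) + (if A ord_max then h ord_max else 0).
Proof.
rewrite big_mkcond big_ord_recl big_ord_recr /= addrA.
have -> : lift ord0 (ord_max : 'I_N.+1) = ord_max :> 'I_N.+2 by apply: val_inj; rewrite /= /bump.
congr (_ + _ + _); rewrite [RHS]big_mkcond; apply: eq_bigr => i _.
rewrite (_ : lift ord0 (widen_ord _ i) = site i) //.
by apply: val_inj; rewrite /= siteE /bump.
Qed.

Lemma sum_sites_adjacent (i : 'I_N) (h : 'I_N.+2 -> R) :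
  \sum_(j : 'I_N.+2 | adjacent (site i) j) h j =
  (if i.+1 == 1%N then h ord0 else 0)
  + \sum_(j < N | adjacent i j) h (site j)
  + (if i.+1 == N then h ord_max else 0).
Proof.
rewrite sum_sites {1 3}/adjacent !siteE /=; congr (_ + _ + _).
  by apply: eq_bigl => j; rewrite /adjacent !siteE !eqSS.
rewrite eqSS eq_sym [i.+1 == N.+2]ltn_eqF ?orbF //.
by rewrite !ltnS ltnW.
Qed.

Lemma sum_adjacent_nat (i : 'I_N.+2) (h : nat -> R) : interior i ->
  \sum_(j : 'I_N.+2 | adjacent i j) h j = h i.-1 + h i.+1.
Proof.
move=> /andP[i0 iN]; have i1 : (i.-1 < N.+2)%N by lia.
have i2 : (i.+1 < N.+2)%N by lia.
have E1 : adjacent i (Ordinal i1) by rewrite /adjacent /=; lia.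
have E2 : adjacent i (Ordinal i2) && (Ordinal i2 != Ordinal i1).
  by rewrite /adjacent -val_eqE /= eqxx /=; lia.
rewrite (bigD1 (Ordinal i1)) //= (bigD1 (Ordinal i2)) //= big1 ?addr0 //.
move=> j; rewrite /adjacent -!val_eqE /=; lia.
Qed.

Lemma sum_adjacent (G : 'I_N -> 'I_N -> R) :
  \sum_(i < N) \sum_(j < N | adjacent i j) G i j =
  \sum_(i < N) \sum_(j < N | j == i.+1 :> nat) (G i j + G j i).
Proof.
transitivity (\sum_(i < N) (\sum_(j < N | j == i.+1 :> nat) G i j
    + \sum_(j < N | i == j.+1 :> nat) G i j)).
  apply: eq_bigr => i _; rewrite (bigID (fun j : 'I_N => j == i.+1 :> nat)) /=.
  congr (_ + _); apply: eq_bigl => j; rewrite /adjacent.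
    by rewrite andb_idl // => ->.
  by case: (_ =P i.+1) => [->|_]; rewrite ?andbT // andbF; apply/esym/eqP; lia.
rewrite big_split /= [X in _ + X](exchange_big_dep xpredT) //=.
by rewrite -big_split; apply: eq_bigr => i _; rewrite -big_split.
Qed.

End sites.

Section duality.
Context {R : realType}.
Variable kappa : R.
Hypothesis kappa_gt0 : 0 < kappa.

Definition site_duality (k n : nat) : R :=
  (n ^_ k)%:R / \prod_(l < k) (kappa + l%:R).

Lemma kappaD_gt0 k : 0 < kappa + k%:R.
Proof. by rewrite ltr_wpDr ?ler0n. Qed.

Lemma rising_gt0 k : 0 < \prod_(l < k) (kappa + l%:R).
Proof. by apply: prodr_gt0 => l _; exact: kappaD_gt0. Qed.

Lemma ffactS_natr k n : (n ^_ k.+1)%:R = (n ^_ k)%:R * (n%:R - k%:R) :> R.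
Proof.
rewrite ffactnSr natrM; have [kn|nk] := leqP k n; first by rewrite natrB.
by rewrite ffact_small // !mul0r.
Qed.

(** Multiplication by the number [n] of particles, and the rates of the process
    followed by the shifts of [n], act on [site_duality] as operators in the dual
    variable [k]. The truncated subtractions are harmless: the one in [n] comes
    with the factor [n] and the one in [k] with the factor [k]. *)
Lemma site_dualityM k n :
  n%:R * site_duality k n =
  (kappa + k%:R) * site_duality k.+1 n + k%:R * site_duality k n.
Proof.
rewrite /site_duality big_ord_recr /= ffactS_natr.
have := rising_gt0 k; have := kappaD_gt0 k; set r := \prod_(_ < _) _ => *.
by field; rewrite !gt_eqF.
Qed.

Lemma site_duality_pred k n :
  n%:R * site_duality k (n - 1) = (kappa + k%:R) * site_duality k.+1 n.
Proof.
case: n => [|n]; first by rewrite /site_duality ffact0n !mul0r mulr0.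
rewrite subn1 /= /site_duality big_ord_recr /= ffactSS natrM.
have := rising_gt0 k; have := kappaD_gt0 k; set r := \prod_(_ < _) _ => *.
by field; rewrite !gt_eqF.
Qed.

Lemma site_duality_succ k n :
  (kappa + n%:R) * site_duality k (n + 1) =
  (kappa + k%:R) * site_duality k.+1 n
  + (kappa + k%:R + k%:R) * site_duality k n + k%:R * site_duality (k - 1) n.
Proof.
case: k => [|k].
  rewrite /site_duality big_ord_recr !big_ord0 !ffactn0 ffactn1 /=.
  by field; rewrite ?mulr0n ?addr0 gt_eqF.
rewrite subn1 addn1 /= /site_duality !big_ord_recr /= ffactSS natrM.
rewrite !ffactS_natr -!natr1.
have := rising_gt0 k; have := kappaD_gt0 k; have := kappaD_gt0 k.+1.
rewrite -natr1; set r := \prod_(_ < _) _ => *.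
by field; rewrite !gt_eqF.
Qed.

Context {N : nat}.

Variables rhoL rhoR : R.

Definition duality_fun (xi : config N.+2) (eta : config N) : R :=
  rhoL ^+ xi ord0 * (\prod_(i < N) site_duality (xi (site i)) (eta i))
  * rhoR ^+ xi ord_max.

Variable n : nat.
Implicit Types (y : {ffun 'I_n -> 'I_N.+2}) (xi : config N.+2) (eta : config N)
  (i j : 'I_N).

Definition occ y : config N.+2 := [ffun j => (\sum_(a < n) (y a == j))%N].

Definition jump y (a : 'I_n) (j : 'I_N.+2) : {ffun 'I_n -> 'I_N.+2} :=
  [ffun b => if b == a then j else y b].

(** Each particle at an interior site jumps to either neighbouring site at rate
    [kappa], and onto each particle at an interior neighbouring site at rate 1; a
    particle that reaches 0 or N + 1 stays there. The particles are labelled, so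
    that the states form a finite type and the dual of a set of macroscopic
    points is simply the tuple of their positions. The occupation number in the
    rate does not count the moving particle, as no site is adjacent to itself. *)
Definition dual_generator (F : {ffun 'I_n -> 'I_N.+2} -> R) y : R :=
  \sum_(a | interior (y a)) \sum_(j : 'I_N.+2 | adjacent (y a) j)
    (kappa + (if interior j then (occ y j)%:R else 0)) * (F (jump y a j) - F y).

Lemma occ_jump y a (j : 'I_N.+2) : occ (jump y a j) = add_at j (remove_at (y a) (occ y)).
Proof.
apply/ffunP => k; rewrite !ffunE (bigD1 a) //= !ffunE eqxx.
rewrite [X in _ = (X - _ + _)%N](bigD1 a) //= eq_sym [k == j]eq_sym (eq_sym k).
rewrite addKn addnC; congr (_ + _)%N.
by apply: eq_bigr => b ba; rewrite ffunE (negbTE ba).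
Qed.

Lemma sum_occ y (A : pred 'I_N.+2) (g : 'I_N.+2 -> R) :
  \sum_(a | A (y a)) g (y a) = \sum_(i | A i) (occ y i)%:R * g i.
Proof.
rewrite (partition_big y A) //=; apply: eq_bigr => i Ai.
rewrite ffunE natr_sum mulr_suml big_mkcond /=; apply: eq_bigr => a _.
by case: eqP => [->|]; rewrite ?Ai ?mul1r ?mul0r ?andbF.
Qed.

(** Both sides of every local identity are written over the common product of
    the sites that the jump leaves untouched. *)
Definition other1 (xi : config N.+2) (eta : config N) (i : 'I_N) : R :=
  \prod_(k < N | k != i) site_duality (xi (site k)) (eta k).

Lemma duality_fun1 xi (eta : config N) (xi' : config N.+2) (eta' : config N) i :
  (forall k, k != i -> xi' (site k) = xi (site k)) ->
  (forall k, k != i -> eta' k = eta k) ->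
  duality_fun xi' eta' = rhoL ^+ xi' ord0
    * (site_duality (xi' (site i)) (eta' i) * other1 xi eta i)
    * rhoR ^+ xi' ord_max.
Proof.
move=> hxi heta; rewrite /duality_fun (bigD1 i) //=.
congr (_ * (_ * _) * _); apply: eq_bigr => k ki; by rewrite hxi // heta.
Qed.

Definition other2 (xi : config N.+2) (eta : config N) (i j : 'I_N) : R :=
  \prod_(k < N | (k != i) && (k != j)) site_duality (xi (site k)) (eta k).

Lemma duality_fun2 xi eta (xi' : config N.+2) (eta' : config N) i j : i != j ->
  (forall k, k != i -> k != j -> xi' (site k) = xi (site k)) ->
  (forall k, k != i -> k != j -> eta' k = eta k) ->
  duality_fun xi' eta' = rhoL ^+ xi' ord0
    * (site_duality (xi' (site i)) (eta' i) *
       (site_duality (xi' (site j)) (eta' j) * other2 xi eta i j))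
    * rhoR ^+ xi' ord_max.
Proof.
move=> ij hxi heta; rewrite /duality_fun (bigD1 i) //= (bigD1 j) 1?eq_sym //=.
congr (_ * (_ * (_ * _)) * _); apply: eq_bigr => k /andP[ki kj].
by rewrite hxi // heta.
Qed.

Lemma site_neq0 i : (site i == ord0) = false.
Proof. by rewrite -val_eqE /= siteE. Qed.

Lemma site_neqmax i : (site i == ord_max) = false.
Proof. by rewrite -val_eqE /= siteE eqSS; apply: ltn_eqF. Qed.

Lemma site_eqE i j : (site i == site j) = (i == j).
Proof. exact: (inj_eq site_inj). Qed.

Definition hop xi eta (i j : 'I_N.+2) : R :=
  duality_fun (add_at j (remove_at i xi)) eta - duality_fun xi eta.

(** The terms with one more dual particle cancel. What remains is that every dual
    particle at the boundary leaves at rate [gamma - alpha = kappa] and is replaced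
    by a factor [rhoL]. *)
Lemma duality_left xi eta i :
  rhoL * kappa * (kappa + (eta i)%:R)
    * (duality_fun xi (add_at i eta) - duality_fun xi eta)
  + (rhoL + 1) * kappa * (eta i)%:R
    * (duality_fun xi (remove_at i eta) - duality_fun xi eta)
  = (xi (site i))%:R * (kappa * hop xi eta (site i) ord0).
Proof.
rewrite /hop.
rewrite (@duality_fun1 xi eta xi eta i) // (@duality_fun1 xi eta xi (add_at i eta) i) //;
  last by move=> k ki; rewrite ffunE (negbTE ki) addn0.
rewrite (@duality_fun1 xi eta xi (remove_at i eta) i) //;
  last by move=> k ki; rewrite ffunE (negbTE ki) subn0.
rewrite (@duality_fun1 xi eta (add_at ord0 (remove_at (site i) xi)) eta i) //; last first.
  by move=> k ki; rewrite !ffunE site_neq0 site_eqE (negbTE ki) subn0 addn0.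
rewrite !ffunE !eqxx site_neq0 [ord0 == _]eq_sym site_neq0.
rewrite [ord_max == site _]eq_sym site_neqmax.
rewrite [ord_max == ord0]/= !subn0 !addn0 exprD expr1.
have := site_duality_succ (xi (site i)) (eta i).
have := site_duality_pred (xi (site i)) (eta i).
have := site_dualityM (xi (site i)) (eta i).
set D1 := site_duality _ (eta i + 1); set D2 := site_duality _ (eta i - 1).
set D3 := site_duality (_ - 1) _; set D4 := site_duality _.+1 _.
set D0 := site_duality _ (eta i).
set r := other1 _ _ _; set a := rhoL ^+ _; set b := rhoR ^+ _ => h1 h2 h3.
transitivity (a * b * r * kappa * (rhoL * ((kappa + (eta i)%:R) * D1)
   - rhoL * (kappa * D0 + (eta i)%:R * D0) + (rhoL + 1) * ((eta i)%:R * D2)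
   - (rhoL + 1) * ((eta i)%:R * D0))); first by ring.
rewrite h1 h2 h3; ring.
Qed.

Lemma duality_right xi eta i :
  rhoR * kappa * (kappa + (eta i)%:R)
    * (duality_fun xi (add_at i eta) - duality_fun xi eta)
  + (rhoR + 1) * kappa * (eta i)%:R
    * (duality_fun xi (remove_at i eta) - duality_fun xi eta)
  = (xi (site i))%:R * (kappa * hop xi eta (site i) ord_max).
Proof.
rewrite /hop.
rewrite (@duality_fun1 xi eta xi eta i) // (@duality_fun1 xi eta xi (add_at i eta) i) //;
  last by move=> k ki; rewrite ffunE (negbTE ki) addn0.
rewrite (@duality_fun1 xi eta xi (remove_at i eta) i) //;
  last by move=> k ki; rewrite ffunE (negbTE ki) subn0.
rewrite (@duality_fun1 xi eta (add_at ord_max (remove_at (site i) xi)) eta i) //; last first.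
  by move=> k ki; rewrite !ffunE site_neqmax site_eqE (negbTE ki) subn0 addn0.
rewrite !ffunE !eqxx site_neqmax [ord0 == site _]eq_sym site_neq0.
rewrite [ord_max == site _]eq_sym site_neqmax.
rewrite [ord0 == ord_max]/= !subn0 !addn0 exprD expr1.
have := site_duality_succ (xi (site i)) (eta i).
have := site_duality_pred (xi (site i)) (eta i).
have := site_dualityM (xi (site i)) (eta i).
set D1 := site_duality _ (eta i + 1); set D2 := site_duality _ (eta i - 1).
set D3 := site_duality (_ - 1) _; set D4 := site_duality _.+1 _.
set D0 := site_duality _ (eta i).
set r := other1 _ _ _; set a := rhoL ^+ _; set b := rhoR ^+ _ => h1 h2 h3.
transitivity (a * b * r * kappa * (rhoR * ((kappa + (eta i)%:R) * D1)
   - rhoR * (kappa * D0 + (eta i)%:R * D0) + (rhoR + 1) * ((eta i)%:R * D2)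
   - (rhoR + 1) * ((eta i)%:R * D0))); first by ring.
rewrite h1 h2 h3; ring.
Qed.

(** The terms that raise the number of dual particles cancel, those by two within
    each direction and those by one between the two directions; the rest moves one
    dual particle across the bond. *)
Lemma duality_bond xi eta i j : i != j ->
  (eta i)%:R * (kappa + (eta j)%:R)
    * (duality_fun xi (add_at j (remove_at i eta)) - duality_fun xi eta)
  + (eta j)%:R * (kappa + (eta i)%:R)
    * (duality_fun xi (add_at i (remove_at j eta)) - duality_fun xi eta)
  = (xi (site i))%:R * ((kappa + (xi (site j))%:R) * hop xi eta (site i) (site j))
  + (xi (site j))%:R * ((kappa + (xi (site i))%:R) * hop xi eta (site j) (site i)).
Proof.
move=> ij; have ji : (j == i) = false by rewrite eq_sym; exact: negbTE.
rewrite /hop.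
have E xi' eta' : (forall k, k != i -> k != j -> xi' (site k) = xi (site k)) ->
  (forall k, k != i -> k != j -> eta' k = eta k) ->
  duality_fun xi' eta' = _ := @duality_fun2 xi eta xi' eta' i j ij.
rewrite (E xi eta) // !(E xi (add_at _ _)) //; last 2 first.
- by move=> k ki kj; rewrite !ffunE (negbTE ki) (negbTE kj) subn0 addn0.
- by move=> k ki kj; rewrite !ffunE (negbTE ki) (negbTE kj) subn0 addn0.
rewrite !(E (add_at _ _) eta) //; last 2 first.
- by move=> k ki kj; rewrite !ffunE !site_eqE (negbTE ki) (negbTE kj) subn0 addn0.
- by move=> k ki kj; rewrite !ffunE !site_eqE (negbTE ki) (negbTE kj) subn0 addn0.
rewrite !ffunE !site_eqE !eqxx ji (negbTE ij) !subn0 !addn0.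
rewrite ![ord0 == site _]eq_sym !site_neq0 ![ord_max == site _]eq_sym !site_neqmax.
rewrite !subn0 !addn0.
have := site_duality_succ (xi (site i)) (eta i).
have := site_duality_pred (xi (site i)) (eta i).
have := site_dualityM (xi (site i)) (eta i).
have := site_duality_succ (xi (site j)) (eta j).
have := site_duality_pred (xi (site j)) (eta j).
have := site_dualityM (xi (site j)) (eta j).
rewrite !addn1.
set A1 := site_duality _ (eta i).+1; set A2 := site_duality _ (eta i - 1).
set A3 := site_duality (_ - 1) (eta i); set A4 := site_duality (xi (site i)).+1 _.
set A0 := site_duality (xi (site i)) (eta i).
set B1 := site_duality _ (eta j).+1; set B2 := site_duality _ (eta j - 1).
set B3 := site_duality (_ - 1) (eta j); set B4 := site_duality (xi (site j)).+1 _.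
set B0 := site_duality (xi (site j)) (eta j).
set r := other2 _ _ _ _; set a := rhoL ^+ _; set b := rhoR ^+ _.
set ei : R := (eta i)%:R; set ej : R := (eta j)%:R.
move=> b1 b2 b3 a1 a2 a3.
transitivity (a * b * r * ((ei * A2) * ((kappa + ej) * B1)
    - (ei * A0) * (kappa * B0 + ej * B0)
    + (ej * B2) * ((kappa + ei) * A1)
    - (ej * B0) * (kappa * A0 + ei * A0))); first by ring.
rewrite a1 a2 a3 b1 b2 b3; ring.
Qed.

(** The rates on the two sides are matched site by site and bond by bond; only the
    bookkeeping of neighbours is global. *)
Lemma duality m alpha gamma sigma beta y eta :
  kappa = m / 2 -> alpha = rhoL * kappa -> gamma = (rhoL + 1) * kappa ->
  sigma = rhoR * kappa -> beta = (rhoR + 1) * kappa ->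
  sip_generator m alpha gamma sigma beta (duality_fun (occ y)) eta =
  dual_generator (fun y => duality_fun (occ y) eta) y.
Proof.
move=> hk -> -> -> ->; rewrite /dual_generator /sip_generator -hk.
set xi := occ y.
under [RHS]eq_bigr do under eq_bigr do rewrite occ_jump -/xi.
pose g (i : 'I_N.+2) := \sum_(j : 'I_N.+2 | adjacent i j)
  (kappa + (if interior j then (xi j)%:R else 0)) * hop xi eta i j.
rewrite -/(g _) (sum_occ y interior g) -/xi sum_sites add0r.
have -> : interior (ord_max : 'I_N.+2) = false by rewrite /interior /= ltnn.
rewrite addr0; under [RHS]eq_bigl do rewrite interior_site.
have gE i : g (site i) = (if i.+1 == 1%N then kappa * hop xi eta (site i) ord0 else 0)
    + \sum_(j < N | adjacent i j)
        (kappa + (xi (site j))%:R) * hop xi eta (site i) (site j)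
    + (if i.+1 == N then kappa * hop xi eta (site i) ord_max else 0).
  rewrite /g sum_sites_adjacent /= addr0; congr (_ + _ + _).
    by apply: eq_bigr => j _; rewrite interior_site.
  by rewrite /interior /= ltnn addr0.
under [RHS]eq_bigr do rewrite gE 2!mulrDr mulr_sumr.
rewrite [RHS]big_split /= [X in _ = X + _]big_split /=; congr (_ + _ + _).
- rewrite [LHS]big_mkcond; apply: eq_bigr => i _.
  by case: ifP => _; [exact: duality_left|rewrite mulr0].
- rewrite sum_adjacent; apply: eq_bigr => i _; apply: eq_bigr => j /eqP ij.
  by apply: duality_bond; rewrite -val_eqE /= ij ltn_eqF.
- rewrite [LHS]big_mkcond; apply: eq_bigr => i _.
  by case: ifP => _; [exact: duality_right|rewrite mulr0].
Qed.

End duality.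

(** * A Lyapunov function for the inclusion process *)

Section generator.
Context {R : realType} {N : nat}.
Variables m alpha gamma sigma beta : R.
Local Notation L := (@sip_generator R m alpha gamma sigma beta N).

Lemma sip_generator_le (f h : config N -> R) eta :
  0 <= m -> 0 <= alpha -> 0 <= gamma -> 0 <= sigma -> 0 <= beta ->
  (forall z, f z <= h z) -> f eta = h eta -> L f eta <= L h eta.
Proof.
move=> m0 a0 g0 s0 b0 fh e; rewrite /sip_generator e.
have k0 k : 0 <= m / 2 + k%:R by rewrite addr_ge0 ?divr_ge0 ?ler0n.
by rewrite !lerD //; apply: ler_sum => i _; [|apply: ler_sum => j _|];
  rewrite lerD // ler_wpM2l ?mulr_ge0 ?ler0n // lerB.
Qed.

Lemma sip_generator_lin (a b c : R) (f h : config N -> R) eta :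
  L (fun z => a * f z + b * h z + c) eta = a * L f eta + b * L h eta.
Proof.
rewrite /sip_generator 4!mulrDr addrACA [X in _ = X + _]addrACA.
congr (_ + _ + _); rewrite !mulr_sumr -big_split; apply: eq_bigr => i _ /=.
- ring.
- by rewrite !mulr_sumr -big_split; apply: eq_bigr => j _ /=; ring.
- ring.
Qed.
End generator.

Section total.
Context {N : nat}.
Implicit Type eta : config N.

Definition total eta : nat := (\sum_i eta i)%N.

Lemma total_add eta i : total (add_at i eta) = (total eta).+1.
Proof.
rewrite /total (bigD1 i) //= [in RHS](bigD1 i) //= ffunE eqxx addn1 addSn.
by congr (_ + _).+1; apply: eq_bigr => j /negbTE ji; rewrite ffunE ji addn0.
Qed.

Lemma total_remove eta i : (0 < eta i)%N ->
  (total (remove_at i eta)).+1 = total eta.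
Proof.
move=> e0; rewrite /total (bigD1 i) //= [in RHS](bigD1 i) //= ffunE eqxx subn1 -addSn prednK //.
by congr (_ + _)%N; apply: eq_bigr => j /negbTE ji; rewrite ffunE ji subn0.
Qed.

Lemma finite_total_lt K : finite_set [set eta : config N | (total eta < K)%N].
Proof.
pose f (g : {ffun 'I_N -> 'I_K.+1}) : config N := [ffun i => g i : nat].
apply: (@sub_finite_set _ _ (range f)); last first.
  by apply: finite_image; exact: finite_finset.
move=> eta /= etaK; exists [ffun i => inord (eta i)] => //.
apply/ffunP => i; rewrite !ffunE inordK //.
by rewrite ltnS (leq_trans _ (ltnW etaK)) // /total (bigD1 i) //= leq_addr.
Qed.
End total.

Section Lyapunov_function.
Context {R : realType} {M : nat}.
Local Notation N := M.+1.
Variables kappa alpha gamma sigma beta : R.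
Hypotheses (kappa_gt0 : 0 < kappa) (alpha_gt0 : 0 < alpha) (sigma_gt0 : 0 < sigma).
Hypotheses (gammaE : gamma = alpha + kappa) (betaE : beta = sigma + kappa).
Implicit Type eta : config N.

(** Vanishes at both reservoirs and is strictly concave. *)
Definition parabola (x : nat) : R := x%:R * (N.+1%:R - x%:R).

Lemma parabola_second_difference x : (0 < x)%N ->
  (parabola x.-1 - parabola x) + (parabola x.+1 - parabola x) = - 2.
Proof. by case: x => // x _; rewrite /parabola -!natr1; ring. Qed.

Definition weight eta : R := \sum_i parabola (i : 'I_N).+1 * (eta i)%:R.

Lemma weight_add eta i : weight (add_at i eta) = weight eta + parabola i.+1.
Proof.
rewrite /weight (bigD1 i) //= [in RHS](bigD1 i) //= ffunE eqxx natrD mulrDr mulr1.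
rewrite addrAC; congr (_ + _ + _); apply: eq_bigr => j /negbTE ji.
by rewrite ffunE ji addn0.
Qed.

Lemma weight_remove eta i : (0 < eta i)%N ->
  weight (remove_at i eta) = weight eta - parabola i.+1.
Proof.
move=> e0.
rewrite /weight (bigD1 i) //= [in RHS](bigD1 i) //= ffunE eqxx natrB // mulrBr mulr1.
rewrite addrAC; congr (_ + _ + _); apply: eq_bigr => j /negbTE ji.
by rewrite ffunE ji subn0.
Qed.

Lemma parabola_bounds (i : 'I_N) : 1 <= parabola i.+1 <= N%:R ^+ 2.
Proof.
have iN : (i.+1 <= N)%N by [].
have -> : parabola i.+1 = (i.+1 * (N - i))%:R.
  by rewrite /parabola natrM natrB ?(ltnW iN) // -!natr1; ring.
rewrite ler1n -natrX ler_nat muln_gt0 subn_gt0 iN /= expnS expn1.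
by rewrite leq_mul // leq_subr.
Qed.

Lemma weight_bounds eta :
  (total eta)%:R <= weight eta <= N%:R ^+ 2 * (total eta)%:R.
Proof.
rewrite /weight /total natr_sum mulr_sumr; apply/andP; split; apply: ler_sum => i _;
  have /andP[h1 h2] := parabola_bounds i.
- by rewrite -[X in X <= _]mul1r ler_wpM2r.
- by rewrite ler_wpM2r.
Qed.

(** The exchange with one reservoir, of parameters [a] and [g], divided by
    [th ^+ total eta]; [e] is the occupation of the boundary site and [w] its
    weight. The terms in [e * W] have the favourable sign because [a * th <= g],
    and the other terms in [e] are first order in [th - 1] up to
    [- kappa * e * w]. *)
Let boundary_drift (a g W w e th : R) : 0 < a -> 0 <= W -> 0 <= w -> 0 <= e ->
  1 <= th -> g = a + kappa -> a * th <= g ->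
  a * (kappa + e) * ((W + w) * th - W) + g * e * ((W - w) * th^-1 - W) <=
  a * kappa * ((th - 1) * W + th * w)
  + e * w * ((th - 1) * (a + g) - kappa).
Proof.
move=> a0 W0 w0 e0 th1 gE ath.
have th0 : 0 < th by lra.
have thq : th * th^-1 = 1 by rewrite mulfV ?gt_eqF.
have q0 : 0 < th^-1 by rewrite invr_gt0.
set q := th^-1 in thq q0 *.
have g0 : 0 <= g by rewrite gE addr_ge0 // ltW.
have h1 : 0 <= g * (1 - q) - a * (th - 1).
  have -> : g * (1 - q) - a * (th - 1) =
      (g - a * th) * (q * (th - 1)) + (1 - th * q) * (g - a * th + a) by ring.
  by rewrite thq subrr mul0r addr0 !mulr_ge0 // ?subr_ge0 // ltW.
have h2 : 0 <= (th - 1) * (a + g) - kappa - a * th + g * q.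
  have -> : (th - 1) * (a + g) - kappa - a * th + g * q =
      g * (q * (th - 1) ^+ 2 + (1 - th * q) * (th - 2)) by rewrite gE; ring.
  rewrite thq subrr mul0r addr0.
  exact: mulr_ge0 g0 (mulr_ge0 (ltW q0) (sqr_ge0 _)).
rewrite -subr_ge0.
rewrite [X in 0 <= X](_ : _ = e * W * (g * (1 - q) - a * (th - 1))
  + e * w * ((th - 1) * (a + g) - kappa - a * th + g * q)); last by ring.
by rewrite addr_ge0 // !mulr_ge0.
Qed.

(** Summation by parts: the second difference of the parabola gives
    [- 2 * kappa] for every particle, except that bulk jumps do not reach the
    reservoirs, whence the two boundary terms. *)
Lemma bulk_drift eta :
  \sum_(i < N) \sum_(j < N | j == i.+1 :> nat)
     kappa * ((eta i)%:R - (eta j)%:R) * (parabola j.+1 - parabola i.+1) =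
  - (2 * kappa) * (total eta)%:R
  + \sum_(i < N | i.+1 == 1%N) kappa * parabola i.+1 * (eta i)%:R
  + \sum_(i < N | i.+1 == N) kappa * parabola i.+1 * (eta i)%:R.
Proof.
pose G (i j : 'I_N) := kappa * (eta i)%:R * (parabola j.+1 - parabola i.+1).
transitivity (\sum_(i < N) \sum_(j < N | j == i.+1 :> nat) (G i j + G j i)).
  by apply: eq_bigr => i _; apply: eq_bigr => j _; rewrite /G; ring.
rewrite -sum_adjacent.
have GE (i : 'I_N) : \sum_(j < N | adjacent i j) G i j =
    - (2 * kappa) * (eta i)%:R
    + (if i.+1 == 1%N then kappa * parabola i.+1 * (eta i)%:R else 0)
    + (if i.+1 == N then kappa * parabola i.+1 * (eta i)%:R else 0).
  have := sum_sites_adjacent i (fun j => parabola j - parabola i.+1).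
  rewrite (sum_adjacent_nat (fun j => parabola j - parabola i.+1)) ?interior_site //.
  rewrite siteE /= (parabola_second_difference (ltn0Sn i)).
  rewrite /G -mulr_sumr; under [in X in X -> _]eq_bigr do rewrite siteE.
  have -> : parabola 0 = 0 by rewrite /parabola mul0r.
  have -> : parabola N.+1 = 0 by rewrite /parabola subrr mulr0.
  set S := \sum_(_ < N | _) _ => h.
  have -> : S = - 2 + (if i.+1 == 1%N then parabola i.+1 else 0)
     + (if i.+1 == N then parabola i.+1 else 0).
    by move: h; do 2 case: ifP => _; lra.
  by do 2 case: ifP => _; ring.
under eq_bigr do rewrite GE.
rewrite !big_split /= -mulr_sumr -natr_sum /total.
by congr (_ + _ + _); rewrite -big_mkcond.
Qed.

Variable m : R.
Hypothesis kappaE : kappa = m / 2.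
Local Notation L := (@sip_generator R m alpha gamma sigma beta N).

(** The total number of particles is conserved in the bulk, so the exponential
    factor does not feel the quadratic bulk rates, which would defeat a power of
    the weight; the weight in turn makes the number of particles decrease in mean
    although particles are only removed at the boundary. *)
Definition Lyapunov (th : R) eta : R := weight eta * th ^+ total eta.

Lemma Lyapunov_move th eta (i j : 'I_N) : (0 < eta i)%N ->
  Lyapunov th (add_at j (remove_at i eta)) =
  (weight eta - parabola i.+1 + parabola j.+1) * th ^+ total eta.
Proof.
by move=> ei; rewrite /Lyapunov weight_add weight_remove // total_add total_remove.
Qed.

(** The boundary terms left over by [bulk_drift] are compensated by the terms
    [- kappa * e * w] of [boundary_drift]. *)
Lemma Lyapunov_drift th eta : 1 <= th -> alpha * th <= gamma -> sigma * th <= beta ->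
  L (Lyapunov th) eta <= th ^+ total eta *
    (- (2 * kappa) * (total eta)%:R
     + \sum_(i < N | i.+1 == 1%N) (alpha * kappa * ((th - 1) * weight eta + th * parabola i.+1)
          + (eta i)%:R * parabola i.+1 * ((th - 1) * (alpha + gamma)))
     + \sum_(i < N | i.+1 == N) (sigma * kappa * ((th - 1) * weight eta + th * parabola i.+1)
          + (eta i)%:R * parabola i.+1 * ((th - 1) * (sigma + beta)))).
Proof.
move=> th1 ath sth.
have th0 : 0 < th by lra.
have p0 (i : 'I_N) : 0 <= parabola i.+1.
  by have /andP[/(le_trans ler01)] := parabola_bounds i.
have W0 : 0 <= weight eta.
  by have /andP[/(le_trans (ler0n _ _))] := weight_bounds eta.
set t := th ^+ total eta; have t0 : 0 <= t by rewrite exprn_ge0 // ltW.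
have boundary a g (i : 'I_N) : 0 < a -> g = a + kappa -> a * th <= g ->
    a * (kappa + (eta i)%:R) * (Lyapunov th (add_at i eta) - Lyapunov th eta)
    + g * (eta i)%:R * (Lyapunov th (remove_at i eta) - Lyapunov th eta) <=
    t * (a * kappa * ((th - 1) * weight eta + th * parabola i.+1)
     + (eta i)%:R * parabola i.+1 * ((th - 1) * (a + g) - kappa)).
  move=> a0 gE ag.
  apply: le_trans (ler_wpM2l t0 (boundary_drift a0 W0 (p0 i) (ler0n _ (eta i)) th1 gE ag)).
  rewrite {1}/Lyapunov weight_add total_add exprS -/t.
  have -> : g * (eta i)%:R * (Lyapunov th (remove_at i eta) - Lyapunov th eta) =
      g * (eta i)%:R * ((weight eta - parabola i.+1) * th^-1 - weight eta) * t.
    case: (posnP (eta i)) => [->|ei]; first by rewrite mulr0 !mul0r.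
    rewrite /Lyapunov weight_remove // /t -(total_remove ei) exprS; field.
    by rewrite gt_eqF.
  by rewrite /Lyapunov -/t; rewrite le_eqVlt; apply/orP; left; apply/eqP; ring.
have bulk (i j : 'I_N) :
    (eta i)%:R * (kappa + (eta j)%:R)
     * (Lyapunov th (add_at j (remove_at i eta)) - Lyapunov th eta)
    + (eta j)%:R * (kappa + (eta i)%:R)
     * (Lyapunov th (add_at i (remove_at j eta)) - Lyapunov th eta)
    = t * (kappa * ((eta i)%:R - (eta j)%:R) * (parabola j.+1 - parabola i.+1)).
  have E (k l : 'I_N) (c : R) : (eta k)%:R * c
     * (Lyapunov th (add_at l (remove_at k eta)) - Lyapunov th eta) =
     (eta k)%:R * c * (parabola l.+1 - parabola k.+1) * t.
    case: (posnP (eta k)) => [->|ek]; first by rewrite !mul0r.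
    by rewrite Lyapunov_move // /Lyapunov -/t; ring.
  by rewrite !E; ring.
rewrite /sip_generator -kappaE.
under [X in _ + X + _ <= _]eq_bigr do under eq_bigr do rewrite bulk.
under [X in _ + X + _ <= _]eq_bigr do rewrite -mulr_sumr.
rewrite -mulr_sumr bulk_drift.
have le_left := ler_sum (index_enum _)
  (fun (i : 'I_N) (_ : i.+1 == 1%N) => boundary _ _ i alpha_gt0 gammaE ath).
have le_right := ler_sum (index_enum _)
  (fun (i : 'I_N) (_ : i.+1 == N) => boundary _ _ i sigma_gt0 betaE sth).
apply: le_trans (lerD (lerD le_left (lexx _)) le_right) _.
rewrite -!mulr_sumr -!mulrDr ler_wpM2l //.
rewrite le_eqVlt; apply/orP; left; apply/eqP.
set S1 := \sum_(i < N | i.+1 == 1%N) kappa * _ * _.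
set S2 := \sum_(i < N | i.+1 == N) kappa * _ * _.
have split_sum (A : pred 'I_N) (a g : R) :
   \sum_(i < N | A i) (a * kappa * ((th - 1) * weight eta + th * parabola i.+1)
     + (eta i)%:R * parabola i.+1 * ((th - 1) * (a + g) - kappa)) =
   \sum_(i < N | A i) (a * kappa * ((th - 1) * weight eta + th * parabola i.+1)
     + (eta i)%:R * parabola i.+1 * ((th - 1) * (a + g)))
   - \sum_(i < N | A i) kappa * parabola i.+1 * (eta i)%:R.
  by rewrite -sumrB; apply: eq_bigr => i _; ring.
rewrite !split_sum -/S1 -/S2; ring.
Qed.
Lemma Lyapunov_lb th eta : 1 <= th -> th ^+ total eta - 1 <= Lyapunov th eta.
Proof.
move=> th1; have /andP[h _] := weight_bounds eta.
have t1 : 1 <= th ^+ total eta by rewrite exprn_ege1.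
have [/eqP t0|t0] := posnP (total eta).
  by rewrite /Lyapunov (eqP t0) expr0 subrr mulr1; move: h; rewrite (eqP t0).
have : 1 <= weight eta by apply: le_trans h; rewrite ler1n.
rewrite /Lyapunov => h1; apply: (@le_trans _ _ (1 * th ^+ total eta)).
  by rewrite mul1r gerBl.
by rewrite ler_wpM2r // (le_trans ler01).
Qed.

(** For [th] close to 1 the boundary terms are absorbed by half of the bulk drift,
    and the drift is at most [th ^+ k * (B - kappa * k)] at [k] particles. This is
    below [- th ^+ k] except for finitely many [k]. *)
Lemma exists_Lyapunov : exists th C : R, [/\ 1 < th, 0 <= C &
  forall eta, L (Lyapunov th) eta <= C - th ^+ total eta].
Proof.
pose A := N%:R ^+ 2 * (kappa * (alpha + sigma) + (alpha + gamma + sigma + beta)).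
pose B := 2 * kappa * N%:R ^+ 2 * (alpha + sigma).
have g0 : 0 < gamma by rewrite gammaE addr_gt0.
have b0 : 0 < beta by rewrite betaE addr_gt0.
have A0 : 0 <= A by rewrite mulr_ge0 ?sqr_ge0 // !addr_ge0 ?mulr_ge0 ?addr_ge0 // ltW.
have B0 : 0 <= B by rewrite /B !mulr_ge0 ?addr_ge0 // ltW.
(* The four summands of the denominator give [s * A <= kappa],
   [alpha * th <= gamma], [sigma * th <= beta] and [s <= 1]. *)
pose s := kappa / (A + alpha + sigma + kappa).
have den0 : 0 < A + alpha + sigma + kappa.
  by rewrite ltr_wpDl // !addr_ge0 // ltW.
have s0 : 0 < s by rewrite divr_gt0.
have sden : s * (A + alpha + sigma + kappa) = kappa by rewrite divfK // gt_eqF.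
have sA0 : 0 <= s * A by rewrite mulr_ge0 // ltW.
have sa0 : 0 <= s * alpha by rewrite mulr_ge0 // ltW.
have ss0 : 0 <= s * sigma by rewrite mulr_ge0 // ltW.
have sk0 : 0 <= s * kappa by rewrite mulr_ge0 // ltW.
rewrite !mulrDr in sden.
have s1 : s <= 1.
  by rewrite -(ler_pM2r kappa_gt0) mul1r; lra.
pose th := 1 + s; pose n0 := (Num.truncn ((B + 1) / kappa)).+1.
have th1 : 1 < th by rewrite ltrDl.
have th0 : 0 < th by lra.
exists th, ((B + 1) * th ^+ n0); split => // [|eta].
  by rewrite mulr_ge0 ?addr_ge0 // exprn_ge0 // ltW.
have ath : alpha * th <= gamma by rewrite /th gammaE mulrDr mulr1 mulrC lerD2l; lra.
have sth : sigma * th <= beta by rewrite /th betaE mulrDr mulr1 mulrC lerD2l; lra.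
apply: le_trans (Lyapunov_drift eta (ltW th1) ath sth) _.
set t := th ^+ total eta.
have t1 : 1 <= t by rewrite exprn_ege1 // ltW.
set S1 := \sum_(_ < _ | _) _; set S2 := \sum_(_ < _ | _) _.
pose n : R := (total eta)%:R.
have n0' : 0 <= n by rewrite ler0n.
have /andP[_ W2] := weight_bounds eta; rewrite -/n in W2.
have thE : th - 1 = s by rewrite /th addrC addKr.
have bnd a g (i : 'I_N) : 0 < a -> 0 < g ->
   a * kappa * ((th - 1) * weight eta + th * parabola i.+1)
   + (eta i)%:R * parabola i.+1 * ((th - 1) * (a + g)) <=
   s * (N%:R ^+ 2 * (kappa * a + (a + g))) * n + 2 * kappa * N%:R ^+ 2 * a.
  move=> a0 gg0; have /andP[p1 p2] := parabola_bounds i.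
  have ein : (eta i)%:R <= n.
    by rewrite ler_nat /total (bigD1 i) //= leq_addr.
  rewrite thE.
  have h1 : a * kappa * (s * weight eta) <= a * kappa * (s * (N%:R ^+ 2 * n)).
    by rewrite ler_wpM2l ?mulr_ge0 ?(ltW a0) ?(ltW kappa_gt0) // ler_wpM2l // ltW.
  have h2 : a * kappa * (th * parabola i.+1) <= a * kappa * (2 * N%:R ^+ 2).
    apply: ler_wpM2l; first by rewrite mulr_ge0 // ltW.
    by apply: ler_pM => //; [exact: ltW|exact: le_trans p1|rewrite /th; lra].
  have h3 : (eta i)%:R * parabola i.+1 * (s * (a + g)) <=
      (n * N%:R ^+ 2) * (s * (a + g)).
    apply: ler_wpM2r; first by rewrite mulr_ge0 ?addr_ge0 // ltW.
    by apply: ler_pM => //; exact: le_trans p1.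
  rewrite mulrDr; apply: le_trans (lerD (lerD h1 h2) h3) _.
  by rewrite le_eqVlt; apply/orP; left; apply/eqP; ring.
have S1le : S1 <= s * (N%:R ^+ 2 * (kappa * alpha + (alpha + gamma))) * n
    + 2 * kappa * N%:R ^+ 2 * alpha.
  rewrite /S1 (big_pred1 ord0); last by move=> i; rewrite /= eqSS -val_eqE.
  exact: bnd.
have S2le : S2 <= s * (N%:R ^+ 2 * (kappa * sigma + (sigma + beta))) * n
    + 2 * kappa * N%:R ^+ 2 * sigma.
  rewrite /S2 (big_pred1 ord_max); last by move=> i; rewrite /= eqSS -val_eqE.
  exact: bnd.
have drift : - (2 * kappa) * n + S1 + S2 <= B - kappa * n.
  apply: le_trans (lerD (lerD (lexx _) S1le) S2le) _.
  rewrite [X in X <= _](_ : _ = (s * A - 2 * kappa) * n + B); last first.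
    by rewrite /A /B; ring.
  rewrite [X in X <= _]addrC lerD2l -[- (kappa * n)]mulNr.
  by apply: ler_wpM2r => //; lra.
apply: le_trans (ler_wpM2l (le_trans ler01 t1) drift) _.
rewrite lerBrDr -[X in _ + X]mulr1 -mulrDr.
have [n0n|nn0] := leqP n0 (total eta).
  apply: (@le_trans _ _ 0); last by rewrite mulr_ge0 ?addr_ge0 // exprn_ge0 // ltW.
  rewrite mulr_ge0_le0 ?(le_trans ler01 t1) //.
  suff : (B + 1) / kappa <= n by rewrite ler_pdivrMr //; lra.
  apply: (@le_trans _ _ n0%:R); last by rewrite ler_nat.
  by apply/ltW/Num.Theory.truncnS_gt.
rewrite mulrC; apply: (@le_trans _ _ ((B + 1) * t)).
  by rewrite ler_wpM2r ?(le_trans ler01 t1) // addrAC gerBl mulr_ge0 // ltW.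
by rewrite ler_wpM2l ?addr_ge0 // ler_weXn2l ?(ltW th1) // ltnW.
Qed.
End Lyapunov_function.

(** * Stationary means of the generator *)

Section subexponential.
Context {R : realType} {N : nat}.
Implicit Types (f g : config N -> R) (eta : config N).

(** Growth in the number of particles slower than every exponential. Unlike a
    polynomial bound this is stable under products without bookkeeping of
    degrees, and it is all that is needed next to the exponential moment. *)
Definition subexp f :=
  forall th, 1 < th -> exists2 C, 0 <= C & forall eta, `|f eta| <= C * th ^+ total eta.

Lemma subexp_le f g : (forall eta, `|f eta| <= `|g eta|) -> subexp g -> subexp f.
Proof.
move=> fg sg th th1; have [C C0 h] := sg _ th1.
by exists C => // eta; exact: le_trans (fg eta) (h eta).
Qed.

Lemma subexp_cst c : subexp (fun=> c).
Proof.
move=> th th1; exists `|c| => // eta.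
by rewrite ler_peMr // exprn_ege1 // ltW.
Qed.

Lemma subexpD f g : subexp f -> subexp g -> subexp (fun eta => f eta + g eta).
Proof.
move=> sf sg th th1; have [C C0 hf] := sf _ th1; have [C' C0' hg] := sg _ th1.
exists (C + C'); first exact: addr_ge0.
by move=> eta; rewrite mulrDl (le_trans (ler_normD _ _)) // lerD.
Qed.

Lemma subexpM f g : subexp f -> subexp g -> subexp (fun eta => f eta * g eta).
Proof.
move=> sf sg th th1; pose r := Num.sqrt th.
have r1 : 1 < r by rewrite -[1]sqrtr1 ltr_sqrt // (lt_trans ltr01).
have rE : r ^+ 2 = th by rewrite sqr_sqrtr // ltW // (lt_trans ltr01).
have [C C0 hf] := sf _ r1; have [C' C0' hg] := sg _ r1.
exists (C * C'); first exact: mulr_ge0.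
move=> eta; rewrite normrM -rE -exprM mulnC exprM expr2.
by rewrite mulrACA ler_pM.
Qed.

Lemma subexp_sum (I : Type) (r : seq I) (P : pred I) (F : I -> config N -> R) :
  (forall i, subexp (F i)) -> subexp (fun eta => \sum_(i <- r | P i) F i eta).
Proof.
move=> h; elim: r => [|a r IH].
  by apply: subexp_le (subexp_cst 0) => eta; rewrite big_nil.
case Pa: (P a); last by apply: subexp_le IH => eta; rewrite big_cons Pa.
by apply: subexp_le (subexpD (h a) IH) => eta; rewrite big_cons Pa.
Qed.

Lemma subexp_prod (I : Type) (r : seq I) (P : pred I) (F : I -> config N -> R) :
  (forall i, subexp (F i)) -> subexp (fun eta => \prod_(i <- r | P i) F i eta).
Proof.
move=> h; elim: r => [|a r IH].
  by apply: subexp_le (subexp_cst 1) => eta; rewrite big_nil.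
case Pa: (P a); last by apply: subexp_le IH => eta; rewrite big_cons Pa.
by apply: subexp_le (subexpM (h a) IH) => eta; rewrite big_cons Pa.
Qed.

Lemma Bernoulli (s : R) n : 0 <= s -> 1 + n%:R * s <= (1 + s) ^+ n.
Proof.
move=> s0; elim: n => [|n IH]; first by rewrite mul0r addr0 expr0.
rewrite exprS; apply: le_trans (ler_wpM2l _ IH); last by rewrite addr_ge0.
rewrite -subr_ge0 -natr1 [X in 0 <= X](_ : _ = n%:R * (s * s)); last by ring.
by rewrite !mulr_ge0.
Qed.

Lemma subexp_total : subexp (fun eta => (total eta)%:R).
Proof.
move=> th th1; have s0 : 0 < th - 1 by rewrite subr_gt0.
exists (th - 1)^-1; first by rewrite invr_ge0 ltW.
move=> eta; rewrite ger0_norm // mulrC ler_pdivlMr //.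
have := Bernoulli (total eta) (ltW s0); rewrite addrCA subrr addr0.
by apply: le_trans; rewrite lerDr.
Qed.

Lemma subexp_ffact k i : subexp (fun eta => (eta i ^_ k)%:R).
Proof.
elim: k => [|k IH]; first by apply: subexp_le (subexp_cst 1) => eta; rewrite ffactn0.
apply: subexp_le (subexpM IH subexp_total) => eta.
rewrite ffactnSr natrM !normrM ler_wpM2l // !ger0_norm // ler_nat.
by rewrite (leq_trans (leq_subr _ _)) // /total (bigD1 i) //= leq_addr.
Qed.

(** With [x ^+ 2 = th ^+ total eta], a multiple of [x] is below a small multiple of
    [x ^+ 2] plus a constant. *)
Lemma subexp_small f th e : subexp f -> 1 < th -> 0 < e ->
  exists2 c, 0 <= c & forall eta, `|f eta| <= e * th ^+ total eta + c.
Proof.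
move=> sf th1 e0; pose r := Num.sqrt th.
have r1 : 1 < r by rewrite -[1]sqrtr1 ltr_sqrt // (lt_trans ltr01).
have rE : r ^+ 2 = th by rewrite sqr_sqrtr // ltW // (lt_trans ltr01).
have [C C0 hf] := sf _ r1.
exists (C ^+ 2 / (4 * e)); first by rewrite divr_ge0 ?sqr_ge0 // mulr_ge0 // ltW.
move=> eta; apply: le_trans (hf eta) _; rewrite -rE -exprM mulnC exprM.
set x := r ^+ _; rewrite -subr_ge0.
rewrite [X in 0 <= X](_ : _ = (2 * e * x - C) ^+ 2 / (4 * e)); last first.
  by field; rewrite gt_eqF.
by rewrite divr_ge0 ?sqr_ge0 // mulr_ge0 // ltW.
Qed.

Lemma subexp_duality_fun (kappa rhoL rhoR : R) xi :
  subexp (duality_fun (N := N) kappa rhoL rhoR xi).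
Proof.
apply: subexpM; last exact: subexp_cst.
apply: subexpM; first exact: subexp_cst.
apply: subexp_prod => i; rewrite /site_duality.
by apply: subexpM; [exact: subexp_ffact|exact: subexp_cst].
Qed.
End subexponential.

Lemma measurable_config (N : nat) d (T : measurableType d)
  (f : config N -> T) : measurable_fun [set: config N] f.
Proof. by move=> _ A mA. Qed.

Section stationary_moments.
Context {R : realType} {M : nat}.
Local Notation N := M.+1.
Variables m rhoL rhoR : R.
Hypotheses (m_gt0 : 0 < m) (rhoL_gt0 : 0 < rhoL) (rhoR_gt0 : 0 < rhoR).
Let kappa := m / 2.
Local Notation L := (@sip_generator R m (rhoL * kappa) ((rhoL + 1) * kappa)
  (rhoR * kappa) ((rhoR + 1) * kappa) N).
Variables (P : R -> R.-pker (config N) ~> (config N)) (nu : probability (config N) R).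
Hypotheses (genP : has_generator P L) (statP : stationary P nu).

Let kappa_gt0 : 0 < kappa. Proof. by rewrite divr_gt0. Qed.

Lemma sip_Foster_Lyapunov (V g : config N -> R) (e c : R) :
  0 < e -> (forall eta, e * (total eta)%:R <= V eta) ->
  (forall eta, 0 <= g eta) -> 0 <= c -> (forall eta, L V eta <= c - g eta) ->
  (\int[nu]_eta (g eta)%:E <= c%:E)%E.
Proof.
move=> e0 Ve g0 c0 LV.
apply: (Foster_Lyapunov genP statP _ (measurable_config V) (measurable_config g)) LV => //.
- by move=> f h eta; apply: sip_generator_le; rewrite ?mulr_ge0 ?addr_ge0 // ltW.
- by move=> eta; apply: le_trans (Ve eta); rewrite mulr_ge0 // ltW.
- move=> K; apply: sub_finite_set (finite_total_lt (Num.truncn (K / e)).+1) => eta /=.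
  move=> VK; rewrite -(ltr_nat R) (lt_le_trans _ (ltW (Num.Theory.truncnS_gt _))) //.
  by rewrite ltr_pdivlMr // mulrC (le_lt_trans (Ve eta)).
Qed.

Lemma exists_exp_moment : exists th C : R, [/\ 1 < th, 0 <= C,
  (forall eta, L (Lyapunov th) eta <= C - th ^+ total eta) &
  (\int[nu]_eta (th ^+ total eta)%:E <= C%:E)%E].
Proof.
have [th [C [th1 C0 LV]]] : exists th C : R, [/\ 1 < th, 0 <= C &
    forall eta, L (Lyapunov th) eta <= C - th ^+ total eta].
  apply: (@exists_Lyapunov _ _ kappa); rewrite ?mulr_gt0 ?mulrDl ?mul1r //.
exists th, C; split => //.
have s0 : 0 < th - 1 by rewrite subr_gt0.
apply: (sip_Foster_Lyapunov s0 _ _ C0 LV) => eta; last first.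
  by rewrite exprn_ge0 // (le_trans ler01) // ltW.
apply: le_trans (Lyapunov_lb eta (ltW th1)).
have := Bernoulli (total eta) (ltW s0).
by rewrite [1 + (th - 1)]addrC subrK mulrC -lerBrDl.
Qed.

Lemma subexp_integrable f : subexp f -> nu.-integrable setT (EFin \o f).
Proof.
have [th [C [th1 C0 _ momC]]] := exists_exp_moment.
move=> sf; have [c c0 hf] := sf _ th1.
have t0 eta : 0 <= th ^+ total eta by rewrite exprn_ge0 // (le_trans ler01) // ltW.
have it : nu.-integrable setT (fun eta => (th ^+ total eta)%:E).
  apply/integrableP; split; first exact: measurable_config.
  under eq_integral do rewrite /= ger0_norm //.
  by apply: le_lt_trans momC _; rewrite ltry.
have := integrableZl measurableT c it; apply: le_integrable => //.
by move=> eta _ /=; rewrite lee_fin (le_trans (hf eta)) // ler_norm.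
Qed.

(** Adding a small multiple of the Lyapunov function makes [f] and [- f] proper,
    so that the moment bound applies to both signs. *)
Lemma stationary_generator0 f : subexp f -> subexp (L f) ->
  \int[nu]_eta L f eta = 0.
Proof.
move=> sf sLf.
have [th [C [th1 C0 LV momC]]] := exists_exp_moment.
have s0 : 0 < th - 1 by rewrite subr_gt0.
have t0 eta : 0 <= th ^+ total eta by rewrite exprn_ge0 // (le_trans ler01) // ltW.
set I := \int[nu]_eta L f eta.
have IE : (\int[nu]_eta (L f eta)%:E)%E = I%:E.
  by rewrite /I /Rintegral fineK // integrable_fin_num //; exact: subexp_integrable.
have key s e : s * s = 1 -> 0 < e -> - (s * I) <= e * C.
  move=> ss e0.
  have s1 : `|s| = 1.
    apply/eqP; rewrite -(@eqrXn2 _ 2) // expr1n.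
    by rewrite real_normK ?num_real // expr2 ss.
  have e20 : 0 < e / 2 by rewrite divr_gt0.
  have [c1 c10 h1] := subexp_small sf th1 e20.
  have [c2 c20 h2] := subexp_small sLf th1 e0.
  pose V eta := e * Lyapunov th eta + s * f eta + (c1 + e).
  pose g eta := e * th ^+ total eta + c2 - s * L f eta.
  have g0 eta : 0 <= g eta.
    rewrite /g subr_ge0; apply: le_trans (h2 eta).
    by rewrite -[X in _ <= X]mul1r -s1 -normrM ler_norm.
  have c0 : 0 <= e * C + c2 by rewrite addr_ge0 // mulr_ge0 // ltW.
  have : (\int[nu]_eta (g eta)%:E <= (e * C + c2)%:E)%E.
    apply: (@sip_Foster_Lyapunov V g (e / 2 * (th - 1))) => //.
    - by rewrite mulr_gt0.
    - move=> eta; have hV := Lyapunov_lb eta (ltW th1).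
      have hf : - (s * f eta) <= e / 2 * th ^+ total eta + c1.
        apply: le_trans (h1 eta).
        by rewrite -mulNr -[X in _ <= X]mul1r -s1 -normrN -normrM ler_norm.
      have hB := Bernoulli (total eta) (ltW s0).
      rewrite [1 + (th - 1)]addrC subrK in hB.
      have hV' : e * (th ^+ total eta - 1) <= e * Lyapunov th eta.
        by apply: ler_wpM2l hV; exact: ltW.
      have hB' : e / 2 * (1 + (total eta)%:R * (th - 1)) <= e / 2 * th ^+ total eta.
        by apply: ler_wpM2l hB; exact: ltW.
      by rewrite /V; lra.
    - move=> eta; rewrite sip_generator_lin /g.
      have : e * L (Lyapunov th) eta <= e * (C - th ^+ total eta).
        by apply: ler_wpM2l (LV eta); exact: ltW.
      by lra.
  have it : nu.-integrable setT (EFin \o (fun eta => th ^+ total eta)).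
    apply/integrableP; split; first exact: measurable_config.
    under eq_integral do rewrite /= ger0_norm //.
    by apply: le_lt_trans momC _; rewrite ltry.
  have iL : nu.-integrable setT (EFin \o L f) by exact: subexp_integrable.
  have ic : nu.-integrable setT (EFin \o (fun=> c2)).
    exact: subexp_integrable (subexp_cst c2).
  rewrite (_ : (fun eta => (g eta)%:E) = (fun eta =>
     e%:E * (th ^+ total eta)%:E + (c2%:E - s%:E * (L f eta)%:E))%E); last first.
    by apply/funext => eta; rewrite /g -!EFinM -EFinB -EFinD addrA.
  rewrite integralD //; last 2 first.
  - exact: integrableZl.
  - by apply: integrableB => //; exact: integrableZl.
  rewrite integralB //; last exact: integrableZl.
  rewrite !integralZl // integral_cst //= probability_setT mule1.
  set T := (\int[nu]_eta (th ^+ total eta)%:E)%E.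
  have T0 : (0 <= T)%E by apply: integral_ge0 => eta _; rewrite lee_fin.
  have Tfin : T \is a fin_num by rewrite ge0_fin_numE // (le_lt_trans momC) ?ltry.
  rewrite IE -(fineK Tfin) -!EFinM -EFinB -EFinD lee_fin.
  have : 0 <= e * fine T by rewrite mulr_ge0 ?fine_ge0 // ltW.
  by lra.
have keyC s : s * s = 1 -> - (s * I) <= 0.
  move=> ss; apply/ler_addgt0Pr => e e0; rewrite add0r.
  have C1 : 0 < C + 1 by rewrite ltr_wpDl.
  apply: le_trans (key s (e / (C + 1)) ss (divr_gt0 e0 C1)) _.
  by rewrite mulrAC ler_pdivrMr // ler_wpM2l ?lerDl // ltW.
have h1 : - (1 * I) <= 0 by apply: keyC; rewrite mulr1.
have h2 : - (-1 * I) <= 0 by apply: keyC; rewrite mulrNN mulr1.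
 apply/eqP; rewrite eq_le; apply/andP; split; lra.
Qed.
End stationary_moments.

(** * The dual particles are nearly independent *)

Section dual_asymptotics.
Context {R : realType} {N n : nat}.
Variable kappa : R.
Hypothesis kappa_gt0 : 0 < kappa.
Implicit Types (y : {ffun 'I_n -> 'I_N.+2}) (F : {ffun 'I_n -> 'I_N.+2} -> R).
Local Notation Ld := (dual_generator kappa).

Lemma jump_at y a j : jump y a j a = j.
Proof. by rewrite ffunE eqxx. Qed.

Lemma jump_off y a j b : b != a -> jump y a j b = y b.
Proof. by rewrite ffunE => /negbTE ->. Qed.

(** A maximizer with the least sum of positions must be absorbed: at an interior
    particle, harmonicity would make the jump to the left another maximizer. *)
Lemma dual_maximum_principle F :
  (forall y, 0 <= Ld F y) ->
  (forall y, (forall a, ~~ interior (y a)) -> F y <= 0) ->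
  forall y, F y <= 0.
Proof.
move=> LF F0 y.
have [y0 _ maxF'] := @arg_maxP _ _ _ y xpredT F erefl.
have maxF z : F z <= F y0 by exact: maxF'.
have := @arg_minnP _ y0 (fun z => F z == F y0) (fun z => \sum_a z a)%N (eqxx _).
case=> z /eqP Fz minz.
apply: le_trans (maxF y) _; rewrite -Fz; apply: F0 => a.
apply/negP => inta; have /andP[a0 aN] := inta.
pose j : 'I_N.+2 := inord (z a).-1.
have jE : j = (z a).-1 :> nat.
  by rewrite inordK // (leq_ltn_trans (leq_pred _)).
have Fle a' j' : F (jump z a' j') - F z <= 0 by rewrite subr_le0 Fz maxF.
have rate0 j' : 0 <= kappa + (if interior j' then (occ z j')%:R else 0).
  by rewrite addr_ge0 ?(ltW kappa_gt0) //; case: ifP.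
have adj : adjacent (z a) j by rewrite /adjacent jE prednK // eqxx orbT.
have : 0 <= (kappa + (if interior j then (occ z j)%:R else 0)) * (F (jump z a j) - F z).
  apply: le_trans (LF z) _; rewrite /dual_generator (bigD1 a) //= (bigD1 j) //=.
  rewrite -addrA gerDl -[X in _ <= X]addr0; apply: lerD.
    by apply: sumr_le0 => j' _; apply: mulr_ge0_le0.
  by apply: sumr_le0 => a' _; apply: sumr_le0 => j' _; apply: mulr_ge0_le0.
rewrite pmulr_rge0; last by rewrite ltr_wpDr //; case: ifP.
rewrite subr_ge0 Fz => Fj.
have /minz : F (jump z a j) == F y0 by rewrite eq_le Fj maxF.
rewrite leqNgt => /negP; apply.
rewrite (bigD1 a) //= [X in (_ < X)%N](bigD1 a) //= jump_at jE.
rewrite (eq_bigr (fun b => z b : nat)); last by move=> b ba; rewrite jump_off.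
by rewrite ltn_add2r prednK.
Qed.

Lemma dual_generator_lin (a b c : R) (F G H : {ffun 'I_n -> 'I_N.+2} -> R) y :
  Ld (fun z => a * F z + b * G z + c * H z) y =
  a * Ld F y + b * Ld G y + c * Ld H y.
Proof.
rewrite /dual_generator !mulr_sumr -!big_split; apply: eq_bigr => i _ /=.
by rewrite !mulr_sumr -!big_split; apply: eq_bigr => j _ /=; ring.
Qed.

Definition neighbors y (a b : 'I_n) : bool :=
  [&& interior (y a), interior (y b) & adjacent (y a) (y b)].

Lemma neighbors_sym y a b : neighbors y a b = neighbors y b a.
Proof. by rewrite /neighbors andbCA /adjacent orbC. Qed.

Lemma neighbors_irr y a : neighbors y a a = false.
Proof. by rewrite /neighbors /adjacent orbb (ltn_eqF (ltnSn _)) !andbF. Qed.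

Lemma neighbors_neq y a b : neighbors y a b -> a != b.
Proof. by move=> h; apply: contraTneq h => ->; rewrite neighbors_irr. Qed.

(** Independent walkers, plus attraction of each particle to its neighbours. *)
Lemma dual_generatorE F y : Ld F y =
  kappa * (\sum_(a | interior (y a)) \sum_(j : 'I_N.+2 | adjacent (y a) j)
    (F (jump y a j) - F y))
  + \sum_a \sum_(b | neighbors y a b) (F (jump y a (y b)) - F y).
Proof.
rewrite /dual_generator mulr_sumr [X in _ = _ + X](bigID (fun a => interior (y a))) /=.
rewrite [X in _ = _ + (_ + X)]big1 ?addr0; last first.
  by move=> a /negbTE inta; rewrite big1 // => b; rewrite /neighbors inta.
rewrite -big_split; apply: eq_bigr => a inta /=.
under eq_bigr do rewrite mulrDl.
rewrite big_split /= mulr_sumr; congr (_ + _).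
under [RHS]eq_bigl do rewrite /neighbors inta.
rewrite (sum_occ y (fun j : 'I_N.+2 => interior j && adjacent (y a) j)
  (fun j => F (jump y a j) - F y)).
rewrite [LHS]big_mkcond [RHS]big_mkcond; apply: eq_bigr => j _ /=.
by case: (interior j); case: ifP => // _; rewrite mul0r.
Qed.

Lemma neighbors_swap y (f : 'I_n -> 'I_n -> R) :
  \sum_a \sum_(b | neighbors y a b) f a b = \sum_a \sum_(b | neighbors y a b) f b a.
Proof.
rewrite (exchange_big_dep xpredT) //=; apply: eq_bigr => a _.
by apply: eq_bigl => b; rewrite neighbors_sym.
Qed.

Definition neighbor_count y : R := \sum_a \sum_(b | neighbors y a b) 1.

Section product_profile.
Variables rhoL rhoR : R.
Hypotheses (rhoL_gt0 : 0 < rhoL) (rhoR_gt0 : 0 < rhoR).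

Definition profile (j : nat) : R := rhoL + (rhoR - rhoL) * (j%:R / N.+1%:R).
Definition product_profile y : R := \prod_a profile (y a).
Let K := 1 + rhoL + rhoR.

Lemma profile_bounds (j : 'I_N.+2) : 0 <= profile j <= K.
Proof.
rewrite /profile /K; set u := _ / _.
have u0 : 0 <= u by rewrite divr_ge0.
have u1 : u <= 1 by rewrite ler_pdivrMr // mul1r ler_nat -ltnS.
have h1 : 0 <= rhoR * u by rewrite mulr_ge0 // ltW.
have h2 : 0 <= rhoL * (1 - u) by rewrite mulr_ge0 ?subr_ge0 // ltW.
have h3 : rhoR * u <= rhoR by rewrite ler_piMr // ltW.
have h4 : rhoL * (1 - u) <= rhoL by rewrite ler_piMr ?gerBl // ltW.
by apply/andP; split; lra.
Qed.

(** The profile is affine, so independent walkers leave the product invariant.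
    Attraction contributes, after exchanging the two particles of a pair, half of
    the squared slope times the product over the other particles. *)
Lemma product_profile_drift y : 0 <= Ld product_profile y <=
  ((rhoR - rhoL) / N.+1%:R) ^+ 2 * K ^+ n / 2 * neighbor_count y.
Proof.
pose d := (rhoR - rhoL) / N.+1%:R.
pose G1 a := \prod_(b | b != a) profile (y b).
pose G2 a b := \prod_(c | (c != a) && (c != b)) profile (y c).
have GJ a j : product_profile (jump y a j) - product_profile y =
    (profile j - profile (y a)) * G1 a.
  rewrite /product_profile (bigD1 a) //= [X in _ - X](bigD1 a) //= jump_at mulrBl.
  by congr (_ * _ - _); apply: eq_bigr => b ba; rewrite jump_off.
rewrite dual_generatorE big1 ?mulr0 ?add0r; last first.
  move=> a inta; under eq_bigr do rewrite GJ; rewrite -mulr_suml.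
  rewrite (sum_adjacent_nat (fun j => profile j - profile (y a))) //.
  have /andP[a0 _] := inta; rewrite /profile -[in X in X * _](prednK a0) /= -!natr1.
  by rewrite [X in X * _](_ : _ = 0) ?mul0r //; ring.
have G12 a b : b != a -> G1 a = profile (y b) * G2 a b.
  by move=> ba; rewrite /G1 (bigD1 b).
have G2C a b : G2 a b = G2 b a by apply: eq_bigl => c; rewrite andbC.
have G2b a b : 0 <= G2 a b <= K ^+ n.
  rewrite /G2 prodr_ge0 /=; last by move=> c _; case/andP: (profile_bounds (y c)).
  apply: (@le_trans _ _ (\prod_(c < n) K)); last by rewrite prodr_const card_ord.
  rewrite big_mkcond; apply: ler_prod => c _; have /andP[p0 pK] := profile_bounds (y c).
  by case: ifP => _; rewrite ?p0 ?pK // ler01 /K -addrA lerDl addr_ge0 // ltW.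
have -> : \sum_a \sum_(b | neighbors y a b)
      (product_profile (jump y a (y b)) - product_profile y) =
    \sum_a \sum_(b | neighbors y a b) d ^+ 2 * G2 a b / 2.
  pose f a b := (profile (y b) - profile (y a)) * profile (y b) * G2 a b.
  transitivity (\sum_a \sum_(b | neighbors y a b) f a b).
    apply: eq_bigr => a _; apply: eq_bigr => b nab.
    by rewrite GJ (G12 a b) 1?eq_sym ?(neighbors_neq nab) // /f mulrA.
  transitivity (\sum_a \sum_(b | neighbors y a b) (f a b + f b a) / 2).
    set S := LHS; set S' := \sum_a \sum_(b | neighbors y a b) f b a.
    have hS : S = S' := neighbors_swap y f.
    transitivity ((S + S') / 2); first by rewrite -hS; field.
    rewrite -big_split mulr_suml; apply: eq_bigr => a _ /=.
    by rewrite -big_split mulr_suml.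
  apply: eq_bigr => a _; apply: eq_bigr => b /and3P[_ _ nab].
  rewrite /f (G2C b a).
  rewrite [in LHS](_ : _ + _ = (profile (y b) - profile (y a)) ^+ 2 * G2 a b);
    last by ring.
  congr (_ * _ / _); rewrite /profile /d.
  case/orP: nab => /eqP ->; rewrite -natr1; ring.
apply/andP; split.
  by apply: sumr_ge0 => a _; apply: sumr_ge0 => b _; have /andP[h _] := G2b a b;
    rewrite divr_ge0 // mulr_ge0 ?sqr_ge0.
rewrite /neighbor_count mulr_sumr; apply: ler_sum => a _.
rewrite mulr_sumr; apply: ler_sum => b _; rewrite mulr1 ler_pM2r ?invr_gt0 //.
by apply: ler_wpM2l; [exact: sqr_ge0|case/andP: (G2b a b)].
Qed.
End product_profile.

(** Constant at distances 0 and 1, so that attraction does not see it. *)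
Definition separation (x z : nat) : R :=
  N.+2%:R - (maxn 1 ((x - z) + (z - x)))%:R.

Definition total_separation y : R := \sum_a \sum_(b | b != a) separation (y a) (y b).

Lemma separationC x z : separation x z = separation z x.
Proof. by rewrite /separation addnC. Qed.

Lemma separation_bounds (i j : 'I_N.+2) : 0 <= separation i j <= N.+2%:R.
Proof.
rewrite /separation subr_ge0 gerBl ler0n andbT ler_nat.
by have := ltn_ord i; have := ltn_ord j; lia.
Qed.

Lemma separation_second_difference (x z : nat) : (0 < x)%N ->
  (separation x.-1 z - separation x z) + (separation x.+1 z - separation x z) =
  - (if adjacent x z then 1 else 0).
Proof.
move=> x0; pose D (u : nat) := maxn 1 ((u - z) + (z - u)).
have h : (D x.-1 + D x.+1 = 2 * D x + (if adjacent x z then 1 else 0))%N.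
  by rewrite /D /adjacent; case: ifP; lia.
have hD u : separation u z = N.+2%:R - (D u)%:R by [].
rewrite !hD.
have : (D x.-1)%:R + (D x.+1)%:R = 2 * (D x)%:R + (if adjacent x z then 1 else 0) :> R.
  by rewrite -natrD h natrD natrM; case: ifP.
by case: ifP => _; lra.
Qed.

Lemma total_separation_jump y a j :
  total_separation (jump y a j) - total_separation y =
  2 * \sum_(b | b != a) (separation j (y b) - separation (y a) (y b)).
Proof.
pose rest := \sum_(c | c != a) \sum_(b | (b != c) && (b != a)) separation (y c) (y b).
have E (z : {ffun 'I_n -> 'I_N.+2}) : (forall b, b != a -> z b = y b) ->
    total_separation z = 2 * \sum_(b | b != a) separation (z a) (y b) + rest.
  move=> zy; rewrite /total_separation (bigD1 a) //= mulr_natl mulr2n -addrA.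
  congr (_ + _); first by apply: eq_bigr => b ba; rewrite (zy b).
  rewrite /rest -big_split; apply: eq_bigr => c ca /=.
  rewrite (bigD1 a) 1?eq_sym //= (zy c) // separationC; congr (_ + _).
  by apply: eq_bigr => b /andP[_ ba]; rewrite (zy b).
rewrite (E y) // (E (jump y a j)); last by move=> b; exact: jump_off.
by rewrite jump_at [in RHS]sumrB; ring.
Qed.

Lemma total_separation_bounds y : 0 <= total_separation y <= n%:R ^+ 2 * N.+2%:R.
Proof.
apply/andP; split.
  apply: sumr_ge0 => a _; apply: sumr_ge0 => b _.
  by case/andP: (separation_bounds (y a) (y b)).
apply: (@le_trans _ _ (\sum_(a < n) \sum_(b < n) N.+2%:R)).
  apply: ler_sum => a _; rewrite big_mkcond; apply: ler_sum => b _.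
  by case: ifP => _ //; case/andP: (separation_bounds (y a) (y b)).
by rewrite !sumr_const !card_ord expr2 -mulrA !mulr_natl.
Qed.

(** Under the walks the separation of a pair decreases in mean only at distance 1,
    where it has its kink. Attraction does not change the separation of the two
    particles involved, and its effects on a third one cancel in pairs. *)
Lemma total_separation_drift y :
  Ld total_separation y <= - (2 * kappa) * neighbor_count y.
Proof.
rewrite dual_generatorE.
have -> : \sum_a \sum_(b | neighbors y a b)
    (total_separation (jump y a (y b)) - total_separation y) = 0.
  pose f a b := 2 * \sum_(c | (c != a) && (c != b))
     (separation (y b) (y c) - separation (y a) (y c)).
  transitivity (\sum_a \sum_(b | neighbors y a b) f a b).
    apply: eq_bigr => a _; apply: eq_bigr => b nab.
    rewrite total_separation_jump (bigD1 b) /=; last first.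
      by rewrite eq_sym (neighbors_neq nab).
    rewrite [X in X + _](_ : _ = 0) ?add0r //.
    have /and3P[_ _] := nab; rewrite /adjacent /separation => /orP h.
    have -> : maxn 1 (y b - y b + (y b - y b)) = maxn 1 (y a - y b + (y b - y a)).
      by case: h => /eqP ->; lia.
    by rewrite subrr.
  have h := neighbors_swap y f.
  suff : \sum_a \sum_(b | neighbors y a b) f b a = - \sum_a \sum_(b | neighbors y a b) f a b.
    by move=> h2; move: h; rewrite h2; lra.
  rewrite -sumrN; apply: eq_bigr => a _; rewrite -sumrN; apply: eq_bigr => b _.
  rewrite /f -mulrN -sumrN; congr (_ * _); apply: eq_big => [c|c _]; first by rewrite andbC.
  by ring.
rewrite addr0 [- _ * _]mulrC mulrN mulrA [_ * kappa]mulrC -mulrN.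
rewrite ler_pM2l //.
have -> : - (neighbor_count y * 2) =
    \sum_(a | interior (y a)) - ((\sum_(b | neighbors y a b) 1) * 2).
  rewrite /neighbor_count mulr_suml -sumrN (bigID (fun a => interior (y a))) /=.
  rewrite [X in _ + X]big1 ?addr0 // => a /negbTE inta.
  by rewrite big_pred0 ?mul0r ?oppr0 // => b; rewrite /neighbors inta.
apply: ler_sum => a inta.
under eq_bigr do rewrite total_separation_jump.
rewrite -mulr_sumr mulrC -mulNr ler_pM2r // exchange_big /= -sumrN.
rewrite big_mkcond [X in _ <= X]big_mkcond; apply: ler_sum => b _.
rewrite (sum_adjacent_nat (fun j => separation j (y b) - separation (y a) (y b))) //.
have /andP[a0 _] := inta; rewrite separation_second_difference //.
rewrite /neighbors inta /= eq_sym.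
have [<-|ab] := eqVneq a b.
  by rewrite /adjacent orbb (ltn_eqF (ltnSn _)) andbF.
by case: (adjacent _ _); rewrite ?andbT ?andbF //; case: (interior (y b));
  rewrite ?oppr0 ?lerN10 // oppr_le0.
Qed.

(** The product profile is subharmonic, and adding [e] times the total separation,
    with [e] of order [N ^- 2], makes it superharmonic. On absorbed states the
    former equals [H] and the latter is above it. *)
Lemma dual_harmonic_close (rhoL rhoR : R) (H : {ffun 'I_n -> 'I_N.+2} -> R) :
  0 < rhoL -> 0 < rhoR ->
  (forall y, Ld H y = 0) ->
  (forall y, (forall a, ~~ interior (y a)) -> H y = product_profile rhoL rhoR y) ->
  forall y, `|H y - product_profile rhoL rhoR y| <=
    (rhoR - rhoL) ^+ 2 * (1 + rhoL + rhoR) ^+ n * n%:R ^+ 2 / (2 * kappa) / N.+1%:R.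
Proof.
move=> L0 R0 LH HG y.
set G := product_profile rhoL rhoR.
pose c := ((rhoR - rhoL) / N.+1%:R) ^+ 2 * (1 + rhoL + rhoR) ^+ n / 2.
have c0 : 0 <= c.
  rewrite divr_ge0 // mulr_ge0 ?sqr_ge0 //.
  by apply: exprn_ge0; rewrite !addr_ge0 // ltW.
have GH : 1 * G y + -1 * H y + 0 * H y <= 0.
  apply: (dual_maximum_principle (F := fun y => 1 * G y + -1 * H y + 0 * H y)) => z.
    rewrite dual_generator_lin LH !mulr0 !addr0 mul1r.
    by have /andP[] := product_profile_drift L0 R0 z.
  by move=> /HG ->; rewrite /G; lra.
pose e := c / (2 * kappa).
have e0 : 0 <= e by rewrite divr_ge0 // mulr_ge0 // ltW.
have HG' : 1 * H y + -1 * G y + - e * total_separation y <= 0.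
  apply: (dual_maximum_principle
    (F := fun y => 1 * H y + -1 * G y + - e * total_separation y)) => z.
    rewrite dual_generator_lin LH mulr0 add0r mulN1r.
    have /andP[_ h1] := product_profile_drift L0 R0 z.
    have h2 := ler_wpM2l e0 (total_separation_drift z).
    have h3 : e * (- (2 * kappa) * neighbor_count z) = - (c * neighbor_count z).
      by rewrite /e; field; rewrite gt_eqF.
    rewrite h3 in h2; rewrite -/c -/G in h1; lra.
  move=> /HG ->; have /andP[s0 _] := total_separation_bounds z.
  have : 0 <= e * total_separation z by rewrite mulr_ge0.
  by rewrite -/G; lra.
have /andP[_ s1] := total_separation_bounds y.
have bnd : e * total_separation y <=
   (rhoR - rhoL) ^+ 2 * (1 + rhoL + rhoR) ^+ n * n%:R ^+ 2 / (2 * kappa) / N.+1%:R.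
  apply: le_trans (ler_wpM2l e0 s1) _.
  have N2 : N.+2%:R <= 2 * N.+1%:R :> R by rewrite -natrM ler_nat; lia.
  apply: le_trans (ler_wpM2l e0 (ler_wpM2l (sqr_ge0 _) N2)) _.
  rewrite le_eqVlt; apply/orP; left; apply/eqP; rewrite /e /c.
  by field; rewrite !gt_eqF // ltr_wpDr.
rewrite ger0_norm; last by lra.
by apply: le_trans bnd; lra.
Qed.
End dual_asymptotics.

(** * Local equilibrium *)

Section stationary_duality.
Context {R : realType}.
Variables m rhoL rhoR : R.
Hypotheses (m_gt0 : 0 < m) (rhoL_gt0 : 0 < rhoL) (rhoR_gt0 : 0 < rhoR).
Let kappa := m / 2.
Let kappa_gt0 : 0 < kappa. Proof. by rewrite divr_gt0. Qed.

Lemma Gamma_rising (z : R) k : 0 < z ->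
  Gamma (z + k%:R) = \prod_(l < k) (z + l%:R) * Gamma z.
Proof.
move=> z0; elim: k => [|k IH]; first by rewrite addr0 big_ord0 mul1r.
rewrite -natr1 addrA GammaS ?ltr_wpDr // IH big_ord_recr /=; ring.
Qed.

Lemma sip_dualityE N (xi : config N.+2) (eta : config N) :
  sip_duality m rhoL rhoR xi eta = duality_fun kappa rhoL rhoR xi eta.
Proof.
rewrite /sip_duality /duality_fun; congr (_ * _ * _); apply: eq_bigr => i _.
rewrite -/(site i) -/kappa /site_duality; set k := xi _; set n := eta i.
have [kn|nk] := leqP k n; last by rewrite ffact_small // mul0r.
rewrite Gamma_rising // -(ffact_fact kn) natrM.
have f0 : ((n - k)`!%:R : R) != 0 by rewrite pnatr_eq0 -lt0n fact_gt0.
rewrite mulfK //; have := Gamma_gt0 kappa_gt0; have := rising_gt0 kappa_gt0 k.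
set r := \prod_(_ < _) _ => r0 G0.
by field; rewrite !gt_eqF.
Qed.

(** The profile takes the values [rhoL] and [rhoR] at the reservoirs. *)
Lemma duality_fun_absorbed N n (y : {ffun 'I_n -> 'I_N.+2}) (eta : config N) :
  (forall a, ~~ interior (y a)) ->
  duality_fun kappa rhoL rhoR (occ y) eta = product_profile rhoL rhoR y.
Proof.
move=> absy; rewrite /duality_fun big1 ?mulr1; last first.
  move=> i _; rewrite (_ : occ y (site i) = 0%N).
    by rewrite /site_duality ffactn0 big_ord0 divr1.
  rewrite ffunE big1 // => a _; case: eqP => // ya.
  by have := absy a; rewrite ya interior_site.
rewrite !ffunE !expr_sum -big_split; apply: eq_bigr => a _ /=.
have := absy a; rewrite negb_and -leqNgt leqn0 -leqNgt /profile => /orP[/eqP y0|yN].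
  have -> : y a = ord0 by apply: val_inj.
  by rewrite /= mul0r mulr0 addr0; exact: mulr1.
have yN' : y a = ord_max.
  by apply: val_inj; apply/eqP; rewrite eqn_leq yN -ltnS ltn_ord.
rewrite yN' /= divff ?pnatr_eq0 // mulr1 addrC subrK eqxx; exact: mul1r.
Qed.

Definition correlation N (nu : probability (config N) R) n
    (y : {ffun 'I_n -> 'I_N.+2}) : R :=
  \int[nu]_eta duality_fun kappa rhoL rhoR (occ y) eta.

Section fixed_size.
Variable M : nat.
Local Notation N := M.+1.
Local Notation L := (@sip_generator R m (rhoL * kappa) ((rhoL + 1) * kappa)
  (rhoR * kappa) ((rhoR + 1) * kappa) N).
Variables (P : R -> R.-pker (config N) ~> (config N)) (nu : probability (config N) R).
Hypotheses (genP : has_generator P L) (statP : stationary P nu).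

Let integrable_subexp f : subexp f -> nu.-integrable setT (EFin \o f).
Proof. exact: (subexp_integrable m_gt0 rhoL_gt0 rhoR_gt0 genP statP). Qed.

Lemma Rintegral_sum (I : Type) (r : seq I) (A : pred I) (F : I -> config N -> R) :
  (forall i, subexp (F i)) ->
  \int[nu]_eta (\sum_(i <- r | A i) F i eta) = \sum_(i <- r | A i) \int[nu]_eta F i eta.
Proof.
move=> sF; elim: r => [|i r IH].
  under eq_Rintegral do rewrite big_nil.
  by rewrite big_nil Rintegral_cst // mul0r.
rewrite big_cons -IH; under eq_Rintegral do rewrite big_cons.
case: (A i) => //; rewrite RintegralD //; apply: integrable_subexp => //.
exact: subexp_sum.
Qed.

Variable n : nat.
Implicit Type y : {ffun 'I_n -> 'I_N.+2}.
Let D y (eta : config N) := duality_fun kappa rhoL rhoR (occ y) eta.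

Let subexp_D y : subexp (D y). Proof. exact: subexp_duality_fun. Qed.

Let subexp_jump (c : R) y z : subexp (fun eta => c * (D y eta - D z eta)).
Proof.
apply: subexpM; first exact: subexp_cst.
apply: subexpD => //; apply: subexp_le (subexp_D z) => eta.
by rewrite normrN.
Qed.

(** Stationarity makes the mean of the generator vanish, and duality turns it into
    the dual generator of the mean. *)
Lemma correlation_harmonic y : dual_generator kappa (correlation nu (n := n)) y = 0.
Proof.
have E eta : L (D y) eta = dual_generator kappa (D ^~ eta) y.
  by rewrite /D (duality kappa_gt0).
have sL : subexp (L (D y)).
  apply: (@subexp_le _ _ _ (fun eta => dual_generator kappa (D ^~ eta) y)).
    by move=> eta; rewrite E.
  by apply: subexp_sum => a; apply: subexp_sum => j; exact: subexp_jump.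
rewrite -(stationary_generator0 m_gt0 rhoL_gt0 rhoR_gt0 genP statP (subexp_D y) sL).
under eq_Rintegral do rewrite E /dual_generator.
rewrite Rintegral_sum; last first.
  by move=> a; apply: subexp_sum => j; exact: subexp_jump.
apply: eq_bigr => a _; rewrite Rintegral_sum; last by move=> j; exact: subexp_jump.
apply: eq_bigr => j _; rewrite RintegralZl //; last first.
  apply: integrable_subexp; apply: subexpD => //.
  by apply: subexp_le (subexp_D y) => eta; rewrite normrN.
by rewrite RintegralB //; exact: integrable_subexp.
Qed.

Lemma correlation_close y :
  `|correlation nu y - product_profile rhoL rhoR y| <=
  (rhoR - rhoL) ^+ 2 * (1 + rhoL + rhoR) ^+ n * n%:R ^+ 2 / (2 * kappa) / N.+1%:R.
Proof.
apply: dual_harmonic_close => // [z|z absz]; first exact: correlation_harmonic.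
rewrite /correlation /D.
under eq_Rintegral do rewrite duality_fun_absorbed //.
by rewrite Rintegral_cst //= probability_setT mulr1.
Qed.

Lemma duality_integrable y : nu.-integrable setT (EFin \o D y).
Proof. exact: integrable_subexp. Qed.
End fixed_size.

Definition macro_positions n (x : 'I_n -> R) N : {ffun 'I_n -> 'I_N.+2} :=
  [ffun a => inord (Num.truncn (x a * N%:R))].

Lemma macro_position_val n (x : 'I_n -> R) N a : 0 <= x a <= 1 ->
  macro_positions x N a = Num.truncn (x a * N%:R) :> nat.
Proof.
move=> /andP[x0 x1]; rewrite ffunE inordK // ltnS; apply: leqW.
rewrite Num.Theory.truncn_le_nat; apply: (@le_lt_trans _ _ N%:R).
  by rewrite ler_piMl.
by rewrite ltr_nat.
Qed.

Lemma occ_macro n (x : 'I_n -> R) N : (forall a, 0 <= x a <= 1) ->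
  macro_config x N = occ (macro_positions x N).
Proof.
move=> hx; apply/ffunP => j; rewrite !ffunE; apply: eq_bigr => a _.
by rewrite -val_eqE /= macro_position_val.
Qed.
End stationary_duality.

Lemma cvg_inv_succ (R : realType) (c : R) : c / N.+1%:R @[N --> \oo] --> 0.
Proof.
rewrite -(mulr0 c); apply: cvgM; first exact: cvg_cst.
exact: (@cvg_harmonic R).
Qed.

Lemma product_profile_cvg (R : realType) (rhoL rhoR : R) n (x : 'I_n -> R) :
  (forall a, 0 <= x a <= 1) ->
  product_profile rhoL rhoR (macro_positions x N) @[N --> \oo] -->
  \prod_(a < n) (rhoL + (rhoR - rhoL) * x a).
Proof.
move=> hx; rewrite /product_profile.
apply: cvg_big; first exact: mul_continuous.
move=> a _; rewrite /profile.
under eq_fun do rewrite macro_position_val //.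
apply: cvgD; first exact: cvg_cst.
apply: cvgM; first exact: cvg_cst.
have /andP[x0 x1] := hx a.
have h : (Num.truncn (x a * N%:R))%:R / N.+1%:R - x a @[N --> \oo] --> 0.
  apply: (@squeeze_cvgr _ _ _ _ (fun N => (- 2) / N.+1%:R) (fun N => 2 / N.+1%:R)).
  - apply: nearW => N; have N0 : 0 < N.+1%:R :> R by rewrite ltr0n.
    have xN : 0 <= x a * N%:R by rewrite mulr_ge0.
    have /andP[t1 t2] := Num.Theory.truncn_itv xN.
    set t : R := (Num.truncn _)%:R in t1 t2 *.
    have -> : t / N.+1%:R - x a = (t - x a * N.+1%:R) / N.+1%:R.
      by rewrite mulrBl mulfK // gt_eqF.
    rewrite !ler_pM2r ?invr_gt0 // -natr1 in t2 *.
    by rewrite -natr1; apply/andP; split; lra.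
  - exact: cvg_inv_succ.
  - exact: cvg_inv_succ.
rewrite -[X in _ --> X]add0r.
rewrite (_ : (fun N => _) = (fun N =>
  (Num.truncn (x a * N%:R))%:R / N.+1%:R - x a + x a)); last first.
  by apply/funext => N; rewrite subrK.
by apply: (cvgD h); exact: cvg_cst.
Qed.

Theorem mainTheorem3 (R : realType) (m rhoL rhoR alpha gamma sigma beta : R)
  (hm : 0 < m) (hrhoL : 0 < rhoL) (hrhoR : 0 < rhoR)
  (halpha : alpha = rhoL * (m / 2)) (hgamma : gamma = (rhoL + 1) * (m / 2))
  (hsigma : sigma = rhoR * (m / 2)) (hbeta : beta = (rhoR + 1) * (m / 2))
  (P : forall N : nat, R -> R.-pker (config N) ~> (config N))
  (hP : forall N : nat, (0 < N)%N -> markov_semigroup (P N))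
  (hL : forall N : nat, (0 < N)%N ->
    has_generator (P N) (@sip_generator R m alpha gamma sigma beta N))
  (nu : forall N : nat, probability (config N) R)
  (hnu : forall N : nat, (0 < N)%N -> stationary (P N) (nu N)) :
  forall (n : nat) (x : 'I_n -> R), (0 < n)%N ->
    (forall i, 0 <= x i <= 1) ->
    (\int[nu N]_eta (sip_duality m rhoL rhoR (macro_config x N) eta)%:E)%E
      @[N --> \oo] --> (\prod_(i < n) (rhoL + (rhoR - rhoL) * x i))%:E.
Proof.
move=> n x _ hx; subst alpha gamma sigma beta.
have E N : (\int[nu N]_eta (sip_duality m rhoL rhoR (macro_config x N) eta)%:E)%E
    = (\int[nu N]_eta (duality_fun (m / 2) rhoL rhoR (occ (macro_positions x N)) eta)%:E)%E.
  by apply: eq_integral => eta _; rewrite sip_dualityE // occ_macro.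
under eq_fun do rewrite E.
apply/fine_cvgP; split.
  exists 1%N => // -[] // N N0; apply: integrable_fin_num => //.
  exact: (duality_integrable hm hrhoL hrhoR (hL _ N0) (hnu _ N0)).
pose G N := product_profile rhoL rhoR (macro_positions x N).
pose H N := correlation m rhoL rhoR (nu N) (macro_positions x N).
pose C := (rhoR - rhoL) ^+ 2 * (1 + rhoL + rhoR) ^+ n * n%:R ^+ 2 / (2 * (m / 2)).
have HG : H N - G N @[N --> \oo] --> 0.
  apply: (@squeeze_cvgr _ _ _ _ (fun N => - C / N.+1%:R) (fun N => C / N.+1%:R)).
  - exists 1%N => // -[] // N N0 /=.
    by rewrite mulNr -ler_norml; exact: (correlation_close hm hrhoL hrhoR (hL _ N0) (hnu _ N0)).
  - exact: cvg_inv_succ.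
  - exact: cvg_inv_succ.
rewrite -[X in _ --> X]add0r.
rewrite (_ : fine \o _ = (fun N => H N - G N + G N)); last first.
  by apply/funext => N; rewrite subrK.
by apply: (cvgD HG); exact: product_profile_cvg.
Qed.
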